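(* Let $G=(V,E,w)$ be an edge-weighted graph, and for a set of edges $F$ write $w(F)=\sum_{e\in F}w(e)$. For any two spanning forests ${\cal F}$ (source) and ${\cal F}'$ (target) of $G$, ${\cal F}$ can be gradually transformed into ${\cal F}'$ via a sequence of constant-time operations, grouped into phases of two operations each, such that the edge set obtained at the end of each phase is a valid spanning forest of $G$ of weight at most $\max\{w({\cal F}),w({\cal F}')\}$. Moreover, the total running time of this transformation is $O\big((|{\cal F}|+|{\cal F}'|)\log(|{\cal F}|+|{\cal F}'|)\big)$.
   Context: A spanning forest of $G$ is an acyclic subgraph consisting of a spanning tree of each connected component of $G$. A gradual transformation maintains a current edge set initialized to ${\cal F}$; an operation is a single edge insertion or deletion and takes constant time; the transformation ends when the current set equals ${\cal F}'$. *)

(* Defs.v *)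
From HB Require Import structures.
From mathcomp Require Import all_boot all_order all_algebra.
Set Implicit Arguments.
Unset Strict Implicit.
Unset Printing Implicit Defensive.
Import Order.TTheory GRing.Theory Num.Theory.

(** * Graphs and spanning forests *)

(* A finite simple graph on V is its set of edges, each edge being a
   two-element set of vertices; a subgraph (on all of V) is a subset of E. *)
Definition simple_graph (V : finType) (E : {set {set V}}) : Prop :=
  forall e, e \in E -> #|e| = 2.

Definition adj (V : finType) (F : {set {set V}}) : rel V :=
  fun x y => [set x; y] \in F.

(* The bound on the size discards the degenerate closed walk x, y, x. *)
Definition acyclic (V : finType) (F : {set {set V}}) : Prop :=
  forall c : seq V, 2 < size c -> ~ ucycle (adj F) c.

(* F spans every connected component of E: vertices joined by a path in E are
   joined by a path in F. *)
Definition spanning_forest (V : finType) (E F : {set {set V}}) : Prop :=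
  [/\ F \subset E, acyclic F
    & forall x y : V, connect (adj E) x y -> connect (adj F) x y].

Definition weight (R : realDomainType) (V : finType) (w : {set V} -> R)
    (F : {set {set V}}) : R :=
  (\sum_(e in F) w e)%R.

(** * Gradual transformations *)

(* T is the type of edges, or of the numbers that name edges in the machine
   model below. *)
Inductive op (T : Type) := Insert of T | Delete of T.

Definition map_op (T U : Type) (f : T -> U) (o : op T) : op U :=
  match o with Insert e => Insert (f e) | Delete e => Delete (f e) end.

Definition apply_op (V : finType) (S : {set {set V}}) (o : op {set V}) :
    {set {set V}} :=
  match o with Insert e => e |: S | Delete e => S :\ e end.

(* Only an absent edge of the graph can be inserted, and only a present edge
   can be deleted. *)
Definition legal_op (V : finType) (E S : {set {set V}}) (o : op {set V}) :
    bool :=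
  match o with Insert e => e \in E :\: S | Delete e => e \in S end.

(* The phases lead from S to S', and the edge set at the end of every phase
   satisfies good (no condition is put on the set in the middle of a phase). *)
Fixpoint gradual_transformation (V : finType) (E : {set {set V}})
    (good : {set {set V}} -> Prop) (S S' : {set {set V}})
    (phases : seq (op {set V} * op {set V})) : Prop :=
  match phases with
  | [::] => S = S'
  | (o1, o2) :: phases' =>
      let S1 := apply_op S o1 in
      let S2 := apply_op S1 o2 in
      [/\ legal_op E S o1, legal_op E S1 o2, good S2
        & gradual_transformation E good S2 S' phases']
  end.

(* The single operations, in order. *)
Definition ops_of_phases (T : Type) (phases : seq (op T * op T)) : seq (op T) :=
  flatten [seq [:: o.1; o.2] | o <- phases].

(** * Running time *)

(* Algorithms are programs for a unit-cost random access machine with addition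
   and truncated subtraction.  The memory consists of numbered scalar variables
   and of numbered arrays; a program mentions finitely many of them by name.
   Weights are accessible only through constant-time comparisons of the weights
   of two edges, and a program performs an operation on the current edge set by
   the instruction Perform. *)
Inductive expr :=
  | Const of nat
  | Var of nat
  | Get of nat & expr                    (* array, index *)
  | Add of expr & expr
  | Sub of expr & expr.

Inductive test :=
  | Leq of expr & expr
  | WLeq of expr & expr                  (* compares weights, by edge number *)
  | Not of test
  | And of test & test.

Inductive cmd :=
  | Skip
  | Assign of nat & expr
  | Put of nat & expr & expr             (* array, index, value *)
  | Seq of cmd & cmd
  | If of test & cmd & cmd
  | While of test & cmd
  | Perform of op expr.

Record memory := Memory { var : nat -> nat; arr : nat -> nat -> nat }.

Definition set_var (m : memory) (x v : nat) : memory :=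
  Memory (fun y => if y == x then v else var m y) (arr m).

Definition set_arr (m : memory) (a i v : nat) : memory :=
  Memory (var m) (fun b j => if (b == a) && (j == i) then v else arr m b j).

Fixpoint eval (m : memory) (e : expr) : nat :=
  match e with
  | Const n => n
  | Var x => var m x
  | Get a i => arr m a (eval m i)
  | Add e1 e2 => eval m e1 + eval m e2
  | Sub e1 e2 => eval m e1 - eval m e2
  end.

Fixpoint eval_test (wle : rel nat) (m : memory) (b : test) : bool :=
  match b with
  | Leq e1 e2 => eval m e1 <= eval m e2
  | WLeq e1 e2 => wle (eval m e1) (eval m e2)
  | Not b1 => ~~ eval_test wle m b1
  | And b1 b2 => eval_test wle m b1 && eval_test wle m b2
  end.

(* exec wle c m m' tr t: started in m, c halts in m' after t steps, having
   performed the operations tr in this order.  Evaluating the expressions and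
   the test of one instruction is a single step: the number of nodes evaluated
   is bounded in terms of the program alone. *)
Inductive exec (wle : rel nat) :
    cmd -> memory -> memory -> seq (op nat) -> nat -> Prop :=
  | ExecSkip m : exec wle Skip m m [::] 1
  | ExecAssign m x e :
      exec wle (Assign x e) m (set_var m x (eval m e)) [::] 1
  | ExecPut m a i e :
      exec wle (Put a i e) m (set_arr m a (eval m i) (eval m e)) [::] 1
  | ExecSeq c1 c2 m m1 m2 tr1 tr2 t1 t2 :
      exec wle c1 m m1 tr1 t1 -> exec wle c2 m1 m2 tr2 t2 ->
      exec wle (Seq c1 c2) m m2 (tr1 ++ tr2) (t1 + t2)
  | ExecIf b c1 c2 m m' tr t :
      exec wle (if eval_test wle m b then c1 else c2) m m' tr t ->
      exec wle (If b c1 c2) m m' tr t.+1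
  | ExecWhileDone b c m :
      ~~ eval_test wle m b -> exec wle (While b c) m m [::] 1
  | ExecWhileStep b c m m1 m2 tr1 tr2 t1 t2 :
      eval_test wle m b ->
      exec wle c m m1 tr1 t1 -> exec wle (While b c) m1 m2 tr2 t2 ->
      exec wle (While b c) m m2 (tr1 ++ tr2) (t1 + t2).+1
  | ExecPerform m o :
      exec wle (Perform o) m m [:: map_op (eval m) o] 1.

(* Variables and arrays that hold the input. *)
Definition var_sizeF := 0.
Definition var_sizeF' := 1.
Definition arr_end1 := 0.
Definition arr_end2 := 1.
Definition arr_F := 2.
Definition arr_F' := 3.

Definition lists (V : finType) (edge_num : {set V} -> nat) (F : {set {set V}})
    (a : nat -> nat) : Prop :=
  perm_eq (mkseq a #|F|) [seq edge_num e | e <- enum F].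

(* The vertices and the edges are numbered in an arbitrary way; two arrays,
   indexed by edge numbers, store the endpoints of the edges of G; two more
   arrays list the edge numbers of F and of F' in arbitrary order.  All memory
   not used for the input is initially 0. *)
Record input (R : realDomainType) (V : finType) (E : {set {set V}})
    (w : {set V} -> R) (F F' : {set {set V}})
    (vertex_num : V -> nat) (edge_num : {set V} -> nat) (wle : rel nat)
    (m : memory) : Prop :=
  Input {
    vertex_num_lt : forall v, vertex_num v < #|V|;
    vertex_num_inj : injective vertex_num;
    edge_num_lt : {in E, forall e, edge_num e < #|E|};
    edge_num_inj : {in E &, injective edge_num};
    input_wle : {in E &, forall e f,
      wle (edge_num e) (edge_num f) = (w e <= w f)%R};
    input_ends : {in E, forall e, exists x y : V,
      [/\ e = [set x; y], arr m arr_end1 (edge_num e) = vertex_num x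
        & arr m arr_end2 (edge_num e) = vertex_num y]};
    input_sizeF : var m var_sizeF = #|F|;
    input_sizeF' : var m var_sizeF' = #|F'|;
    input_F : lists edge_num F (arr m arr_F);
    input_F' : lists edge_num F' (arr m arr_F');
    input_var0 : forall x, x \notin [:: var_sizeF; var_sizeF'] -> var m x = 0;
    input_arr0 : forall a i,
      a \notin [:: arr_end1; arr_end2; arr_F; arr_F'] -> arr m a i = 0
  }.

Lemma input_exists (R : realDomainType) (V : finType) (E : {set {set V}})
    (w : {set V} -> R) (F F' : {set {set V}}) :
  simple_graph E ->
  exists vertex_num edge_num wle m, input E w F F' vertex_num edge_num wle m.
Proof.
move=> sE.
pose vn (v : V) := nat_of_ord (enum_rank v).
pose en (e : {set V}) := index e (enum E).
pose ed i := nth set0 (enum E) i.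
have edK e : e \in E -> ed (en e) = e.
  by move=> eE; rewrite /ed nth_index ?mem_enum.
pose a k i := match k with
 | 0 => nth 0 [seq vn v | v <- enum (ed i)] 0
 | 1 => nth 0 [seq vn v | v <- enum (ed i)] 1
 | 2 => nth 0 [seq en e | e <- enum F] i
 | 3 => nth 0 [seq en e | e <- enum F'] i
 | _ => 0 end.
exists vn, en, (fun i j => w (ed i) <= w (ed j))%R,
 (Memory (fun x : nat => match x with
                         | 0 => #|F| | 1 => #|F'| | _ => 0 end) a).
split=> //.
- by move=> v; exact: ltn_ord.
- by move=> x y /ord_inj /enum_rank_inj.
- by move=> e eE; rewrite cardE index_mem mem_enum.
- by move=> e f eE fE h; rewrite -(edK e) // -(edK f) // h.
- by move=> e f eE fE /=; rewrite !edK.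
- move=> e eE; rewrite /= edK //.
  move: (sE e eE) (fun z => mem_enum e z); rewrite cardE.
  case: (enum e) => [|x [|y [|]]] //= _ h; exists x, y; split=> //.
  by apply/setP=> z; rewrite -h !inE.
- rewrite /lists /= (_ : mkseq _ _ = [seq en e | e <- enum F]) //.
  by rewrite cardE -(size_map en) mkseq_nth.
- rewrite /lists /= (_ : mkseq _ _ = [seq en e | e <- enum F']) //.
  by rewrite cardE -(size_map en) mkseq_nth.
- by case=> [|[|]].
- by case=> [|[|[|[|]]]].
Qed.

(* Main.v *)
Require Import Defs.
From HB Require Import structures.
From mathcomp Require Import all_boot all_order all_algebra.
From mathcomp Require Import zify.
Set Implicit Arguments.
Unset Strict Implicit.
Unset Printing Implicit Defensive.
Import Order.TTheory GRing.Theory Num.Theory.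

(* Let M be the minimum spanning forest that Kruskal's algorithm extracts from F
   and F'.  We transform F into M by swaps that never increase the weight, and
   then M into F' by reversing the corresponding swaps from F' to M.

   Root F and rank its vertices so that parents have smaller ranks, by peeling
   off leaves.  Let Kruskal's algorithm accept an edge e that joins classes A and
   B, whose vertices of minimal rank are a and b, with rank b <= rank a.  Then e
   is exchanged with the edge f of F from a to its parent.  The current forest
   always consists of the accepted edges and of the parent edges of the vertices
   that are minimal in their classes.  Removing f cuts off the classes whose
   chains of parents pass through A; as ranks decrease along such chains, B is
   not among them, so e reconnects the forest.  If f were lighter than e, its ends
   would already be in the same class, and a would not be minimal there.

   Edges are extracted in order of weight from a tournament tree, and classes are
   maintained by union by size, hence the logarithmic cost per edge.  Peeling
   needs neither adjacency lists nor recursion: for every vertex it suffices to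
   maintain its degree and the sum of the names of its edges, which for a leaf is
   the name of its only edge. *)

(** * Spanning forests *)

Section Graph.
Variable V : finType.
Implicit Types (E F S : {set {set V}}) (e f : {set V}) (x y : V).

Lemma adj_sym F : symmetric (adj F).
Proof. by move=> x y; rewrite /adj setUC. Qed.

Lemma connect_adj_sym F : connect_sym (adj F).
Proof. exact/sym_connect_sym/adj_sym. Qed.

Lemma sub_adj F S : F \subset S -> subrel (adj F) (adj S).
Proof. by move=> /subsetP sFS x y; apply: sFS. Qed.

Lemma connect_sub_adj F S : F \subset S -> subrel (connect (adj F)) (connect (adj S)).
Proof.
by move=> sFS; apply: connect_sub => x y /(sub_adj sFS); apply: connect1.
Qed.

Lemma acyclic_sub F S : F \subset S -> acyclic S -> acyclic F.
Proof.
move=> sFS aS c c2 /andP[cF cu]; apply: (aS c c2); rewrite /ucycle cu andbT.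
exact: sub_cycle (sub_adj sFS) _ cF.
Qed.

Lemma set2_eq x y u v : [set x; y] = [set u; v] ->
  (x = u /\ y = v) \/ (x = v /\ y = u).
Proof.
move=> eq2.
have := set21 x y; have := set22 x y; rewrite eq2 !inE.
have := set21 u v; have := set22 u v; rewrite -eq2 !inE.
do 4![case/orP=> /eqP ?]; subst; by [left | right].
Qed.

(** A cycle avoiding [x] lies in [S]. Otherwise rotate it to start at [x], with neighbours [z] and
    [l] there; the path from [z] to [l] avoids [x], hence lies in [S]. If [z] or [l] is [y], then
    [x] reaches [y] in [S] through the other one; if neither is, the whole cycle is in [S]. *)
Lemma acyclic_add S x y : acyclic S -> ~~ connect (adj S) x y ->
  acyclic ([set x; y] |: S).
Proof.
move=> aS nxy c c2 /andP[cyc uc].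
have adjE u v : adj ([set x; y] |: S) u v -> u != x -> v != x -> adj S u v.
  rewrite /adj !inE => /orP[/eqP/set2_eq[] []-> ->|//]; by rewrite eqxx.
have adjx v : adj ([set x; y] |: S) x v -> v != y -> adj S x v.
  rewrite /adj !inE => /orP[/eqP/set2_eq[] [] |//]; first by move=> _ ->; rewrite eqxx.
  by move=> -> -> ; rewrite eqxx.
case: (boolP (x \in c)) => [xc|xNc]; last first.
  apply: (aS c c2); rewrite /ucycle uc andbT.
  apply: (@sub_in_cycle _ [pred z | z != x] (adj ([set x; y] |: S))) cyc.
    by move=> u v /= ux vx /adjE; apply.
  by apply/allP=> z zc /=; apply: contraNneq xNc => <-.
case: (rot_to xc) => i p rp.
have: cycle (adj ([set x; y] |: S)) (x :: p) by rewrite -rp rot_cycle.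
have: uniq (x :: p) by rewrite -rp rot_uniq.
have: 2 < size (x :: p) by rewrite -rp size_rot.
case: p {rp} => [//|z p]; case/lastP: p => [//|q l] _ up.
rewrite /cycle -rcons_cons rcons_path last_rcons /= => /andP[/andP[xz pq] lx].
move: up; rewrite /= !inE !mem_rcons !inE rcons_uniq !negb_or.
move=> /andP[/and3P[xNz xNl xNq] /andP[/andP[zNl zNq] /andP[lNq uq]]].
have pS : path (adj S) z (rcons q l).
  apply: (@sub_in_path _ [pred t | t != x] (adj ([set x; y] |: S))) pq.
    by move=> u v /= ux vx /adjE; apply.
  rewrite /= eq_sym xNz all_rcons /= eq_sym xNl /=.
  by apply/allP=> t tq /=; apply: contraNneq xNq => <-.
have czl : connect (adj S) z l by apply/connectP; exists (rcons q l); rewrite ?last_rcons.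
rewrite adj_sym in lx.
have [zy|zNy] := eqVneq z y.
  have lNy : l != y by rewrite -zy eq_sym.
  case/negP: nxy; rewrite -zy; apply: (connect_trans (connect1 (adjx _ lx lNy))).
  by rewrite connect_adj_sym.
have xzS := adjx _ xz zNy.
have [ly|lNy] := eqVneq l y.
  by case/negP: nxy; rewrite -ly; apply: connect_trans (connect1 xzS) czl.
apply: (aS (x :: z :: rcons q l)) => //=; first by rewrite size_rcons.
rewrite /ucycle /cycle -rcons_cons rcons_path last_rcons /= xzS pS adj_sym adjx //=.
by rewrite !inE !mem_rcons !inE rcons_uniq !negb_or xNz xNl xNq zNl zNq lNq uq.
Qed.

Lemma adj_neq E x y : simple_graph E -> adj E x y -> x != y.
Proof. by move=> sE /sE; rewrite cards2; case: eqP. Qed.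

Lemma edge_ends E e : simple_graph E -> e \in E ->
  exists x y, e = [set x; y] /\ x != y.
Proof.
by move=> sE /sE/eqP/cards2P[x [y [xy ->]]]; exists x, y.
Qed.

(** Without a vertex of degree one, every nonempty path could be prolonged at its head by a second
    edge, whose far end is new because a return to the path would close a cycle. Paths would then
    outgrow the number of vertices. *)
Lemma acyclic_leaf S e : simple_graph S -> acyclic S -> e \in S ->
  exists v, #|[set f in S | v \in f]| = 1.
Proof.
move=> sS aS eS.
case: (pickP (fun v => #|[set f in S | v \in f]| == 1)) => [v /eqP vP|noleaf].
  by exists v.
exfalso.
have ext x y p : path (adj S) x (y :: p) -> uniq [:: x, y & p] ->
    exists z, path (adj S) z [:: x, y & p] /\ uniq [:: z, x, y & p].
  move=> pxy uxy; have xy : adj S x y by case/andP: pxy.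
  have exyx : [set x; y] \in [set f in S | x \in f] by rewrite inE set21 andbT.
  have := noleaf x; rewrite (cardsD1 [set x; y]) exyx add1n eqSS.
  move/negbT; rewrite -lt0n => /card_gt0P[f]; rewrite !inE => /and3P[fxy fS xf].
  have [a [b [fab ab]]] := edge_ends sS fS.
  have [z fz] : exists z, f = [set x; z].
    move: xf; rewrite fab !inE => /orP[]/eqP->; first by exists b.
    by exists a; rewrite setUC.
  exists z; have xz : adj S x z by rewrite /adj -fz.
  have zx : z != x by rewrite eq_sym (adj_neq sS).
  have zy : z != y by apply: contraNneq fxy => <-; rewrite fz.
  split; first by rewrite /= adj_sym xz.
  rewrite [uniq _]/= -/(uniq [:: x, y & p]) uxy andbT !inE !negb_or zx zy /=.
  apply/negP=> zp; case/splitPr: zp pxy uxy => p1 p2 pxy uxy.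
  apply: (aS [:: x, y & rcons p1 z]) => //; first by rewrite /= size_rcons.
  have pz : path (adj S) x (y :: rcons p1 z).
    by move: pxy; rewrite -cat_rcons -cat_cons cat_path => /andP[].
  have uz : uniq [:: x, y & rcons p1 z].
    by move: uxy; rewrite -cat_rcons -!cat_cons cat_uniq => /andP[].
  by rewrite /ucycle uz andbT /cycle -rcons_cons rcons_path pz /= last_rcons adj_sym.
have [x [y [exy xNy]]] := edge_ends sS eS.
have long k : exists x y p, [/\ path (adj S) x (y :: p), uniq [:: x, y & p] & size p = k].
  elim: k => [|k [a [b [p [pp up sp]]]]].
    by exists x, y, [::]; rewrite /= !inE xNy /adj -exy eS.
  have [z [pz uz]] := ext _ _ _ pp up.
  by exists z, a, (b :: p); rewrite /= sp.
have [a [b [p [_ up sp]]]] := long #|V|.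
have := max_card [in [:: a, b & p]]; by rewrite (card_uniqP up) /= sp ltnNge leqnSn.
Qed.

(** Induction on the path: repeated crossings of the edge in the same direction reduce to one, and
    two opposite crossings cancel, so at most one crossing has to be recorded. *)
Lemma connect_del S u v x y : connect (adj S) x y ->
  let S' := S :\ [set u; v] in
  [\/ connect (adj S') x y,
      connect (adj S') x u /\ connect (adj S') v y
    | connect (adj S') x v /\ connect (adj S') u y].
Proof.
move=> + S'; case/connectP => p; elim: p x => [|z p IH] x /=.
  by move=> _ ->; constructor 1.
case/andP=> xz pz ly.
have [zE|zNE] := eqVneq [set x; z] [set u; v].
  have c0 := connect0 (adj S').
  case: (set2_eq zE) => [[-> zv]|[-> zu]].
    case: (IH z pz ly); rewrite zv.
    - by constructor 2; rewrite c0.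
    - by case=> ? ?; constructor 2; rewrite c0.
    - by case=> ? ?; constructor 1.
  case: (IH z pz ly); rewrite zu.
  - by constructor 3; rewrite c0.
  - by case=> ? ?; constructor 1.
  - by case=> ? ?; constructor 3; rewrite c0.
have xzS : connect (adj S') x z by apply: connect1; rewrite /adj !inE zNE.
case: (IH z pz ly) => [h|[h1 h2]|[h1 h2]].
- by constructor 1; apply: connect_trans h.
- by constructor 2; split=> //; apply: connect_trans h1.
- by constructor 3; split=> //; apply: connect_trans h1.
Qed.

Lemma closed_connectN S (D : pred V) a b :
  (forall x y, adj S x y -> D x = D y) -> D a -> ~~ D b -> ~~ connect (adj S) a b.
Proof.
move=> cD Da; apply: contra => ab.
have /(_ _ _ ab) : forall x y, connect (adj S) x y -> (x \in D) = (y \in D).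
  by apply: closed_connect => x y /cD.
by rewrite -!topredE /= => <-.
Qed.

(** Since [a] and [b] are connected in [S] but not without [f], the two ends of [f] lie on the sides
    of [a] and [b]; the new edge therefore reconnects them, and with them all that [f] connected. *)
Lemma spanning_forest_exchange E S f a b :
  simple_graph E -> spanning_forest E S -> f \in S -> [set a; b] \in E ->
  ~~ connect (adj (S :\ f)) a b -> spanning_forest E ([set a; b] |: (S :\ f)).
Proof.
move=> sE [sSE aS spS] fS abE nab.
set S2 := _ |: _; have sS2 : S :\ f \subset S2 by apply: subsetUr.
split.
- apply/subsetP=> e; rewrite !inE => /orP[/eqP->//|/andP[_]].
  exact: (subsetP sSE).
- by apply: acyclic_add => //; apply: acyclic_sub aS; apply: subsetDl.
move=> x y /spS xyS.
have [u [v [fuv _]]] := edge_ends sE (subsetP sSE _ fS).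
have up := connect_sub_adj sS2.
have abS2 : connect (adj S2) a b by apply: connect1; rewrite /adj !inE eqxx.
have uv : connect (adj S2) u v.
  have := connect_del u v (spS a b (connect1 abE)); rewrite -fuv /=.
  case=> [h|[h1 h2]|[h1 h2]]; first by rewrite h in nab.
    rewrite connect_adj_sym in h1; rewrite connect_adj_sym in h2.
    apply: connect_trans (up _ _ h1) _; apply: connect_trans abS2 _.
    exact: up.
  rewrite connect_adj_sym; rewrite connect_adj_sym in h1; rewrite connect_adj_sym in h2.
  apply: connect_trans (up _ _ h1) _; apply: connect_trans abS2 _.
  exact: up.
have := connect_del u v xyS; rewrite -fuv /=.
case=> [h|[h1 h2]|[h1 h2]]; first exact: up.
  by apply: connect_trans (up _ _ h1) _; apply: connect_trans uv _; apply: up.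
apply: connect_trans (up _ _ h1) _; rewrite connect_adj_sym in uv.
by apply: connect_trans uv _; apply: up.
Qed.

End Graph.

(** * Exchanging edges of a rooted forest *)

Section Rooted.
Variables (V : finType) (E : {set {set V}}).
Implicit Types (F N S : {set {set V}}) (e f : {set V}) (x y v : V).

(** Roots are the vertices of rank 0, at which [pe] and [pv] may take any value. *)
Record rooting (rk : V -> nat) (pe : V -> {set V}) (pv : V -> V) F : Prop :=
  Rooting {
    rooting_edge : forall v, 0 < rk v -> pe v = [set v; pv v];
    rooting_lt : forall v, 0 < rk v -> rk (pv v) < rk v;
    rooting_set : F = [set pe v | v in [pred v | 0 < rk v]]
  }.

(** [N] is the set of accepted edges, [c] labels the current classes, and [rep] chooses a vertex of
    minimal rank in each class, breaking ties consistently. [S] is the current forest. *)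
Record hybrid (rk : V -> nat) (pe : V -> {set V}) (c rep : V -> V) N S : Prop :=
  Hybrid {
    hybrid_N : forall x y, adj N x y -> c x = c y;
    hybrid_rep : forall x, c (rep x) = c x;
    hybrid_repc : forall x y, c x = c y -> rep x = rep y;
    hybrid_min : forall x, rk (rep x) <= rk x;
    hybrid_set : S = N :|: [set pe v | v in [pred v | (0 < rk v) && (rep v == v)]]
  }.

Variables (rk : V -> nat) (pe : V -> {set V}) (pv : V -> V) (F : {set {set V}}).
Hypothesis rF : rooting rk pe pv F.

(** Two distinct vertices with the same parent edge would be parents of each other, against the
    decrease of ranks. *)
Lemma rooting_inj u v : 0 < rk u -> 0 < rk v -> pe u = pe v -> u = v.
Proof.
move=> u0 v0; rewrite (rooting_edge rF u0) (rooting_edge rF v0).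
case/set2_eq=> [[]//|[uE vE]].
have := rooting_lt rF u0; have := rooting_lt rF v0; rewrite -uE vE; lia.
Qed.

Lemma hybrid_init c : injective c -> hybrid rk pe c id set0 F.
Proof.
move=> cI; split=> //; first by move=> x y; rewrite /adj inE.
rewrite set0U (rooting_set rF); apply/setP=> e.
by apply/imsetP/imsetP=> -[v]; rewrite !inE ?eqxx ?andbT => h ->; exists v => //;
  rewrite inE ?h ?eqxx // ; case/andP: h.
Qed.

Variables (c rep : V -> V) (N S : {set {set V}}).
Hypothesis hS : hybrid rk pe c rep N S.

Let repK x : rep (rep x) = rep x.
Proof. by apply: (hybrid_repc hS); apply: (hybrid_rep hS). Qed.

(** A parent has smaller rank, whereas a representative has minimal rank in its class. *)
Lemma hybrid_pv_neq v : 0 < rk v -> rep v = v -> c (pv v) != c v.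
Proof.
move=> v0 vr; apply/eqP=> /(hybrid_repc hS) h.
by have := hybrid_min hS (pv v); rewrite h vr leqNgt (rooting_lt rF v0).
Qed.

Lemma hybrid_pe_notin v : 0 < rk v -> rep v = v -> pe v \notin N.
Proof.
move=> v0 vr; apply/negP; rewrite (rooting_edge rF v0) => /(hybrid_N hS)/esym/eqP.
exact/negP/hybrid_pv_neq.
Qed.

(** Serves at the end of Kruskal's algorithm: once every parent edge lies inside a class, every
    representative is a root, by [hybrid_pv_neq]. *)
Lemma hybrid_root_final : (forall v, 0 < rk v -> c (pv v) = c v) -> S = N.
Proof.
move=> h; rewrite (hybrid_set hS); apply/setUidPl/subsetP=> e /imsetP[v].
by rewrite inE => /andP[v0 /eqP vr]; have := hybrid_pv_neq v0 vr; rewrite h ?eqxx.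
Qed.

Section Step.
Variables (a b : V).
Hypotheses (sE : simple_graph E) (fS : spanning_forest E S).
Hypothesis (abE : [set a; b] \in E).
Hypothesis (cab : c a != c b).
Hypothesis (rab : rk (rep b) <= rk (rep a)).

Let al := rep a.
(** On representatives, this is the parent map of [F] after contraction of the classes, with the
    roots as fixed points. *)
Let g v := if 0 < rk v then rep (pv v) else v.

Let g_lt v : 0 < rk v -> rk (g v) < rk v.
Proof.
by move=> v0; rewrite /g v0; apply: leq_ltn_trans (hybrid_min hS _) (rooting_lt rF v0).
Qed.

Let fg_le u v : fconnect g u v -> rk v <= rk u.
Proof.
move=> /iter_findex <-; elim: (findex _ _ _) => // n IH; rewrite iterS.
apply: leq_trans IH; move: (iter n g u) => z.
by case: (posnP (rk z)) => [h|/g_lt/ltnW//]; rewrite /g h ltnn h.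
Qed.

(* The vertices below al in the forest obtained from F by contracting N. *)
Let D := [pred x | fconnect g (rep x) al].

Let D_a : D a. Proof. exact: connect0. Qed.

(** [rep b] differs from [al] and has no larger rank, while each step of [g] from a vertex of
    positive rank lowers the rank; so no chain from [rep b] arrives at [al]. *)
Let D_bN : ~~ D b.
Proof.
apply/negP=> /= h; have neq : rep b != al.
  by apply: contraNneq cab => h1; rewrite -(hybrid_rep hS a) -/al -h1 (hybrid_rep hS).
case: (posnP (rk (rep b))) => [b0|b0].
  have itb n : iter n g (rep b) = rep b by elim: n => //= n ->; rewrite /g b0.
  by rewrite -(iter_findex h) itb eqxx in neq.
have h1 : fconnect g (g (rep b)) al.
  move: neq; rewrite -(iter_findex h); case: (findex _ _ _) => [|n _]; first by rewrite eqxx.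
  by rewrite iterSr fconnect_iter.
by have := leq_ltn_trans (fg_le h1) (g_lt b0); rewrite ltnNge rab.
Qed.

(** Edges of [N] do not leave a class. Any other edge of [T] is the parent edge of a representative
    [v] other than [al], and such a [v] reaches [al] exactly if [g v] does. *)
Let D_closed (T : {set {set V}}) : T \subset S -> (0 < rk al -> pe al \notin T) ->
  forall x y, adj T x y -> D x = D y.
Proof.
move=> /subsetP TS alT x y xyT; have := TS _ xyT.
rewrite (hybrid_set hS) inE => /orP[/(hybrid_N hS)/(hybrid_repc hS)|].
  by rewrite /D /= => ->.
case/imsetP=> v; rewrite inE => /andP[v0 /eqP vr] xyE.
have vNal : v != al.
  by apply: contraTneq xyT => val; rewrite /adj xyE val; apply: alT; rewrite -val.
have Dv : D v = D (pv v).
  have gv : g v = rep (pv v) by rewrite /g v0.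
  rewrite /D /= vr -gv; apply/idP/idP=> h; last exact: connect_trans (fconnect1 g v) h.
  move: vNal; rewrite -(iter_findex h); case: (findex _ _ _) => [|n _]; first by rewrite eqxx.
  by rewrite iterSr fconnect_iter.
by move: xyE; rewrite (rooting_edge rF v0) => /set2_eq[] [-> ->].
Qed.

(** If [rep a] were a root, no edge of [S] would leave [D], which contains [a] and not [b]; but [S]
    connects the ends of the edge [[set a; b]] of [E]. *)
Lemma hybrid_rk_gt0 : 0 < rk (rep a).
Proof.
case: posnP => // a0.
have : connect (adj S) a b by case: fS => _ _; apply; apply: connect1.
apply: contraTT => _; apply: (closed_connectN _ D_a D_bN).
by apply: D_closed => //; rewrite a0.
Qed.

Let al0 : 0 < rk al. Proof. exact: hybrid_rk_gt0. Qed.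

Lemma hybrid_pe_in : pe (rep a) \in S.
Proof.
by rewrite (hybrid_set hS) inE (imset_f pe) ?orbT // inE hybrid_rk_gt0 repK eqxx.
Qed.

Lemma hybrid_nconnect : ~~ connect (adj (S :\ pe (rep a))) a b.
Proof.
apply: (closed_connectN _ D_a D_bN); apply: D_closed => //; first exact: subsetDl.
by move=> _; rewrite !inE eqxx.
Qed.

Lemma hybrid_new_notin : [set a; b] \notin S :\ pe (rep a).
Proof. by apply: contra hybrid_nconnect => h; apply: connect1. Qed.

Lemma hybrid_step_forest : spanning_forest E ([set a; b] |: (S :\ pe (rep a))).
Proof.
exact: spanning_forest_exchange sE fS hybrid_pe_in abE hybrid_nconnect.
Qed.

(** [rep b] survives, its rank being at most that of [rep a]. *)
Definition merge_rep := fun x => if c x == c a then rep b else rep x.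

(** The labelling [c'] is left abstract, since union by size decides which root names the merged
    class independently of which representative survives. *)
Lemma hybrid_step_hybrid (c' : V -> V) :
  (forall x y, c x = c y -> c' x = c' y) -> c' a = c' b ->
  (forall x y, c' x = c' y ->
     c x = c y \/ (c x \in [:: c a; c b]) && (c y \in [:: c a; c b])) ->
  hybrid rk pe c' merge_rep ([set a; b] |: N) ([set a; b] |: (S :\ pe (rep a))).
Proof.
move=> cc' c'ab c'c; split.
- move=> x y; rewrite /adj !inE => /orP[/eqP/set2_eq[] [-> ->]//|].
  by move/(hybrid_N hS)/cc'.
- move=> x; rewrite /merge_rep; case: eqP => [xa|_].
    by rewrite (cc' _ _ xa) c'ab; apply: cc'; apply: (hybrid_rep hS).
  by apply: cc'; apply: (hybrid_rep hS).
- move=> x y /c'c[xy|]; first by rewrite /merge_rep xy (hybrid_repc hS xy).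
  have mE z : c z \in [:: c a; c b] -> merge_rep z = rep b.
    rewrite /merge_rep !inE; case: eqP => //= _ /eqP.
    exact: (hybrid_repc hS).
  by move=> /andP[/mE-> /mE->].
- move=> x; rewrite /merge_rep; case: eqP => [xa|_]; last exact: (hybrid_min hS).
  by apply: leq_trans rab _; rewrite -(hybrid_repc hS xa) (hybrid_min hS).
(* The only vertex that ceases to be a representative is [al], and its parent edge is exactly the
   one deleted. *)
rewrite -setUA; congr (_ :|: _); rewrite (hybrid_set hS); apply/setP=> e.
rewrite !inE; have [->|eNf] /= := eqVneq e (pe al).
  rewrite ?eqxx /= ?orbF (negbTE (hybrid_pe_notin al0 (repK a))) /=.
  apply/esym/negbTE/imsetP=> -[v]; rewrite inE /merge_rep => /andP[v0 vr].
  move/(rooting_inj al0 v0) => va; move: vr; rewrite -va /al (hybrid_rep hS) eqxx => /eqP ba.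
  by move: cab; rewrite -(hybrid_rep hS b) ba (hybrid_rep hS) eqxx.
rewrite ?eNf /=; congr (_ || _).
apply/imsetP/imsetP=> -[v]; rewrite inE => /andP[v0 vr] ev; exists v => //;
  rewrite inE v0 /=; move: vr; rewrite /merge_rep.
  case: (eqVneq (c v) (c a)) => // /(hybrid_repc hS) h /eqP vr; case/eqP: eNf.
  by rewrite ev -vr h.
case: (eqVneq (c v) (c a)) => // va /eqP bv; case/eqP: cab.
by rewrite -va -bv (hybrid_rep hS).
Qed.

Lemma weight_exchange (R : realDomainType) (w : {set V} -> R) e f :
  (e \in S -> e = f) -> f \in S -> (w e <= w f)%R ->
  (weight w (e |: (S :\ f)) <= weight w S)%R.
Proof.
move=> eS fS' wef; rewrite /weight (big_setD1 f fS') /=.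
rewrite big_setU1 /= ?lerD2r // !inE; apply/negP=> /andP[ef /eS h].
by rewrite h eqxx in ef.
Qed.

End Step.
End Rooted.

(** * Programs and the tournament tree *)

Declare Scope cmd_scope.
Delimit Scope cmd_scope with C.
Bind Scope cmd_scope with cmd.
Infix ";;" := Seq (at level 60, right associativity) : cmd_scope.

Section Run.
Variable wle : rel nat.

(** Halting is part of the assertion, so the rules below form a calculus of total correctness in
    which [Q] also speaks of the trace and of the time. *)
Definition run c m (Q : memory -> seq (op nat) -> nat -> Prop) :=
  exists m' tr t, exec wle c m m' tr t /\ Q m' tr t.

Lemma run_conseq c m (Q Q' : memory -> seq (op nat) -> nat -> Prop) :
  run c m Q -> (forall m' tr t, Q m' tr t -> Q' m' tr t) -> run c m Q'.
Proof. by move=> [m' [tr [t [ex q]]]] QQ'; exists m', tr, t; split=> //; exact: QQ'. Qed.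

Lemma run_skip m (Q : memory -> seq (op nat) -> nat -> Prop) :
  Q m [::] 1 -> run Skip m Q.
Proof. by exists m, [::], 1; split=> //; constructor. Qed.

Lemma run_assign m x e (Q : memory -> seq (op nat) -> nat -> Prop) :
  Q (set_var m x (eval m e)) [::] 1 -> run (Assign x e) m Q.
Proof. by exists (set_var m x (eval m e)), [::], 1; split=> //; constructor. Qed.

Lemma run_put m a i e (Q : memory -> seq (op nat) -> nat -> Prop) :
  Q (set_arr m a (eval m i) (eval m e)) [::] 1 -> run (Put a i e) m Q.
Proof. by exists (set_arr m a (eval m i) (eval m e)), [::], 1; split=> //; constructor. Qed.

Lemma run_perform m o (Q : memory -> seq (op nat) -> nat -> Prop) :
  Q m [:: map_op (eval m) o] 1 -> run (Perform o) m Q.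
Proof. by exists m, [:: map_op (eval m) o], 1; split=> //; constructor. Qed.

Lemma run_seq c1 c2 m (Q : memory -> seq (op nat) -> nat -> Prop) :
  run c1 m (fun m1 tr1 t1 => run c2 m1 (fun m2 tr2 t2 => Q m2 (tr1 ++ tr2) (t1 + t2))) ->
  run (Seq c1 c2) m Q.
Proof.
move=> [m1 [tr1 [t1 [e1 [m2 [tr2 [t2 [e2 q]]]]]]]].
by exists m2, (tr1 ++ tr2), (t1 + t2); split=> //; econstructor; eassumption.
Qed.

Lemma run_if b c1 c2 m (Q : memory -> seq (op nat) -> nat -> Prop) :
  (eval_test wle m b -> run c1 m (fun m' tr t => Q m' tr t.+1)) ->
  (~~ eval_test wle m b -> run c2 m (fun m' tr t => Q m' tr t.+1)) ->
  run (If b c1 c2) m Q.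
Proof.
have mk c : (if eval_test wle m b then c1 else c2) = c ->
    run c m (fun m' tr t => Q m' tr t.+1) -> run (If b c1 c2) m Q.
  move=> cE [m' [tr [t [ex q]]]]; exists m', tr, t.+1; split=> //.
  by constructor; rewrite cE.
by case: ifP mk => [bT mk /(_ isT)/(mk _ erefl)|bF mk _ /(_ isT)/(mk _ erefl)].
Qed.

(** The invariant carries the trace accumulated so far and a potential [p] that bounds the remaining
    time. The strict inequality pays for the test of each round, and the final extra unit for the
    failing test. *)
Lemma run_while (I : memory -> seq (op nat) -> nat -> Prop) b c m tr p :
  (forall m tr p, I m tr p -> eval_test wle m b ->
     run c m (fun m' tr' t => exists p', I m' (tr ++ tr') p' /\ t + p' < p)) ->
  I m tr p ->
  run (While b c) m (fun m' tr' t =>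
     exists p', [/\ I m' (tr ++ tr') p', ~~ eval_test wle m' b & t + p' <= p.+1]).
Proof.
move=> step; have [k] := ubnP p; elim: k => // k IH in m tr p *.
rewrite ltnS => pk Imp; case: (boolP (eval_test wle m b)) => [bT|bF]; last first.
  by exists m, [::], 1; split; [constructor | exists p; rewrite cats0].
have [m1 [tr1 [t1 [e1 [p1 [I1 lt1]]]]]] := step _ _ _ Imp bT.
have [|m2 [tr2 [t2 [e2 [p2 [I2 b2 le2]]]]]] := IH _ _ _ _ I1; first lia.
exists m2, (tr1 ++ tr2), (t1 + t2).+1; split; first by econstructor; eassumption.
by exists p2; rewrite catA; split=> //; lia.
Qed.

End Run.

Ltac step :=
  lazymatch goal with
  | |- run _ (Seq _ _) _ _ => apply: run_seq
  | |- run _ (Assign _ _) _ _ => apply: run_assign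
  | |- run _ (Put _ _ _) _ _ => apply: run_put
  | |- run _ (Perform _) _ _ => apply: run_perform
  | |- run _ Skip _ _ => apply: run_skip
  end.
Ltac steps := repeat step.

Definition Lt e1 e2 := Leq (Add e1 (Const 1)) e2.
Definition Eq e1 e2 := And (Leq e1 e2) (Leq e2 e1).

(* Variables (v..) and arrays (a..); 0, 1 and 0, 1, 2, 3 respectively hold the input. *)
Local Notation vk := 0.
Local Notation vk' := 1.
Local Notation vn := 2.
Local Notation vj := 3.
Local Notation va := 4.
Local Notation vb := 5.
Local Notation ve := 6.
Local Notation vf := 7.
Local Notation vc := 8.
Local Notation vi := 9.
Local Notation vs := 10.
Local Notation aE1 := 0.
Local Notation aE2 := 1.
Local Notation aF := 2.
Local Notation aF' := 3.
Local Notation aUp := 4.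
Local Notation aSz := 5.
Local Notation aDeg := 6.
Local Notation aSum := 7.
Local Notation aRk := 8.
Local Notation aPar := 9.
Local Notation aEL := 10.
Local Notation aU := 11.
Local Notation aW := 12.
Local Notation aHalf := 13.
Local Notation aT := 14.
Local Notation aSe := 15.
Local Notation aSf := 16.

Definition same_arrs (l : seq nat) (m m' : memory) :=
  forall a, a \notin l -> arr m' a = arr m a.
Definition same_vars (l : seq nat) (m m' : memory) :=
  forall x, x \notin l -> var m' x = var m x.

Lemma same_arrs_put l m0 m a i v :
  same_arrs l m0 m -> a \in l -> same_arrs l m0 (set_arr m a i v).
Proof.
move=> h al b bl; rewrite /= -h //; case: eqP => // ba.
by rewrite ba al in bl.
Qed.

Lemma same_arrs_var l m0 m x v : same_arrs l m0 m -> same_arrs l m0 (set_var m x v).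
Proof. by []. Qed.

Lemma same_vars_put l m0 m a i v : same_vars l m0 m -> same_vars l m0 (set_arr m a i v).
Proof. by []. Qed.

Lemma same_vars_var l m0 m x v :
  same_vars l m0 m -> x \in l -> same_vars l m0 (set_var m x v).
Proof.
move=> h al b bl; rewrite /= -h //; case: eqP => // ba.
by rewrite ba al in bl.
Qed.

Lemma same_arrs_trans l l' m m1 m2 : all (mem l) l' ->
  same_arrs l m m1 -> same_arrs l' m1 m2 -> same_arrs l m m2.
Proof.
move=> /allP sub h1 h2 a al; rewrite h2 ?h1 //.
by apply: contra al => /sub.
Qed.

Lemma same_vars_trans l l' m m1 m2 : all (mem l) l' ->
  same_vars l m m1 -> same_vars l' m1 m2 -> same_vars l m m2.
Proof.
move=> /allP sub h1 h2 a al; rewrite h2 ?h1 //.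
by apply: contra al => /sub.
Qed.

Ltac frame := repeat lazymatch goal with
  | |- same_arrs _ _ (set_arr ?m ?a ?i ?v) => apply: (@same_arrs_put _ _ m a i v) => //
  | |- same_arrs _ _ (set_var ?m ?x ?v) => apply: (@same_arrs_var _ _ m x v)
  | |- same_vars _ _ (set_arr ?m ?a ?i ?v) => apply: (@same_vars_put _ _ m a i v)
  | |- same_vars _ _ (set_var ?m ?x ?v) => apply: (@same_vars_var _ _ m x v) => //
  | |- _ => assumption
  end.

(** * The tournament tree that selects the lightest remaining edge *)

Section Heap.
Variables (wle : rel nat) (el : nat -> nat) (n : nat).

(* A node holds the number of the leaf with the lightest edge below it, or 0 if
   all leaves below it are empty; the leaves are numbered from n > 0. *)
Definition better x y := (0 < x) && ((y == 0) || wle (el x) (el y)).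
Definition win x y := if better x y then x else y.

Definition heap_at (t : nat -> nat) i := t i = win (t (i + i)) (t (i + i).+1).

(** The machine cannot divide, so parents of nodes are looked up in the table [aHalf]. The nested
    test is [better] spelled out with [And] and [Not], the only connectives. *)
Definition sift : cmd :=
  (While (Leq (Const 2) (Var vi))
    (Assign vi (Get aHalf (Var vi));;
     Assign va (Get aT (Add (Var vi) (Var vi)));;
     Assign vb (Get aT (Add (Add (Var vi) (Var vi)) (Const 1)));;
     If (And (Lt (Const 0) (Var va))
             (Not (And (Lt (Const 0) (Var vb))
                (Not (WLeq (Get aEL (Var va)) (Get aEL (Var vb)))))))
       (Put aT (Var vi) (Var va)) (Put aT (Var vi) (Var vb))))%C.

Definition sift_vars := [:: vi; va; vb].

(** Invariantly, the tree is correct except perhaps at the parent of the current node; recomputing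
    that parent shifts the possible defect one level up, until the root is passed. *)
Lemma run_sift m :
  arr m aEL = el -> 0 < var m vi < n + n ->
  (forall i, 1 < i < n + n -> arr m aHalf i = i./2) ->
  (forall i, 0 < i < n -> i != (var m vi)./2 -> heap_at (arr m aT) i) ->
  run wle sift m (fun m' tr t =>
    [/\ tr = [::], t <= 7 * trunc_log 2 (var m vi) + 1,
        same_arrs [:: aT] m m' /\ same_vars sift_vars m m',
        forall i, 0 < i < n -> heap_at (arr m' aT) i
      & forall p, n <= p -> arr m' aT p = arr m aT p]).
Proof.
move=> elE vi0 halfE hp.
pose I m' (tr : seq (op nat)) p :=
  [/\ tr = [::], p = 7 * trunc_log 2 (var m' vi) /\ 0 < var m' vi < n + n,
        same_arrs [:: aT] m m' /\ same_vars sift_vars m m',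
        forall i, 0 < i < n -> i != (var m' vi)./2 -> heap_at (arr m' aT) i
      & forall p, n <= p -> arr m' aT p = arr m aT p].
apply: run_conseq.
  apply: (run_while (I := I) (tr := [::]) (p := 7 * trunc_log 2 (var m vi))) => //.
  move=> {}m1 tr p [-> [-> vi1] [fa fv] hp1 lf] /= i2.
  have hfE : arr m1 aHalf (var m1 vi) = (var m1 vi)./2.
    by rewrite fa // halfE //; lia.
  have elE1 : arr m1 aEL = el by rewrite fa.
  set i := var m1 vi in vi1 hp1 i2 hfE *.
  have iD : trunc_log 2 i = (trunc_log 2 i./2).+1 by apply: trunc_log2S.
  have iN : 0 < i./2 < n by lia.
  have key x : x = win (arr m1 aT (i./2 + i./2)) (arr m1 aT (i./2 + i./2).+1) ->
    forall j, 0 < j < n -> j != (i./2)./2 ->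
      heap_at (fun k => if k == i./2 then x else arr m1 aT k) j.
    move=> xE j jn jN; rewrite /heap_at.
    have -> : (j + j == i./2) = false by apply/eqP; lia.
    have -> : ((j + j).+1 == i./2) = false by apply/eqP; lia.
    by case: eqP => [->|/eqP jN2] //; apply: hp1.
  steps; rewrite /= hfE; apply: run_if => /= tst; step; exists (7 * trunc_log 2 i./2);
    (split; last by lia); split=> //=; rewrite ?hfE.
  - by split=> //; lia.
  - by split; frame.
  - move=> j jn jN; have := key _ _ j jn jN; apply.
    move: tst; rewrite !addn1 elE1 negb_and negbK -eqn0Ngt => tst.
    by rewrite /win /better tst.
  - by move=> q qn; rewrite ifN ?lf //; lia.
  - by split=> //; lia.
  - by split; frame.
  - move=> j jn jN; have := key _ _ j jn jN; apply.
    move: tst; rewrite !addn1 elE1 (negb_and _ (~~ wle _ _)) negbK -eqn0Ngt => tst.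
    by rewrite /win /better (negbTE tst).
  - by move=> q qn; rewrite ifN ?lf //; lia.
move=> m' tr t [p' [[/= -> [-> vi1] fr hp1 lf] vi2 tp]]; split=> //; first lia.
by move=> i i0; apply: hp1 => //; lia.
Qed.


(** Two inductions: every node holds 0 or a leaf in [A]; and along the halving chain from a leaf in
    [A], every winner weighs no more than that leaf. The chain ends at node 1. *)
Lemma heap_rootP (t : nat -> nat) (A : pred nat) p :
  (forall i, 0 < i < n -> heap_at t i) ->
  (forall p, n <= p < n + n -> t p = if A p then p else 0) ->
  {in [pred p | n <= p < n + n] & &, transitive (fun p q => wle (el p) (el q))} ->
  {in [pred p | n <= p < n + n] &, total (fun p q => wle (el p) (el q))} ->
  n <= p < n + n -> A p ->
  [/\ n <= t 1 < n + n, A (t 1) &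
    forall q, n <= q < n + n -> A q -> wle (el (t 1)) (el q)].
Proof.
move=> hp lf tr tot pn Ap.
have leaf i : 0 < i < n + n -> t i = 0 \/ n <= t i < n + n /\ A (t i).
  have [k] := ubnP (n + n - i); elim: k => // k IH in i *; move=> ik i0.
  case: (leqP n i) => ni.
    by rewrite lf ?ni; [case: ifP => [Ai|_]; [right; split|left]; lia | lia].
  rewrite hp /win; last lia.
  by case: ifP => _; apply: IH; lia.
have up q : n <= q < n + n -> A q -> forall i, 0 < i < n + n ->
    (exists k, i = iter k half q) -> 0 < t i /\ wle (el (t i)) (el q).
  move=> qn Aq i i0 [k ik]; move: i0; rewrite {}ik {i}; elim: k => [|k IH].
    rewrite /= lf // Aq => _; split; first lia.
    by have /orP[] := tot q q qn qn.
  have zq : iter k half q <= q by elim: (k) => //= k'; lia.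
  rewrite iterS; move: (iter k half q) zq IH => z zq IH z0.
  have z2 : 1 < z by move: z0; lia.
  have zn : z < n + n by lia.
  have [tz0 wz] := IH ltac:(lia).
  have [h|[tzn Az]] := leaf z ltac:(lia); first by rewrite h in tz0.
  have win0 x y : x = 0 \/ n <= x < n + n /\ A x -> y = 0 \/ n <= y < n + n /\ A y ->
      (x = t z \/ y = t z) -> 0 < win x y /\ wle (el (win x y)) (el q).
    move=> xP yP xy; rewrite /win /better.
    case: (posnP x) xP xy => [-> _|x0].
      by case=> [h|->]; [rewrite -h in tz0 | split].
    case=> [h|[xn Ax]]; first by rewrite h in x0.
    case: (posnP y) yP => [-> _|y0].
      by case=> [->|h]; [split | rewrite -h in tz0].
    case=> [h|[yn Ay]]; first by rewrite h in y0.
    have totxy := tot x y xn yn.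
    case: ifP => /= [xy|xy] [] h.
    - by rewrite h.
    - by split=> //; apply: (tr y) => //; rewrite h.
    - move: totxy; rewrite xy /= => yx; split=> //.
      by apply: (tr x) => //; rewrite h.
    - by rewrite h.
  rewrite hp; last lia.
  apply: win0; [apply: leaf; lia | apply: leaf; lia |].
  case: (boolP (odd z)) => oz; [right | left]; congr t; lia.
have root1 q : 0 < q < n + n -> exists k, 1 = iter k half q.
  have [k] := ubnP q; elim: k => // k IH in q *; move=> qk q0.
  case: (ltnP 1 q) => q1; last by exists 0 => /=; lia.
  by have [|k' ->] := IH q./2 ltac:(lia); [lia | exists k'.+1; rewrite iterSr].
have [t0 _] := up p pn Ap 1 ltac:(lia) (root1 p ltac:(lia)).
have [h|[tn At]] := leaf 1 ltac:(lia); first by rewrite h in t0.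
split=> // q qn Aq.
by have [] := up q qn Aq 1 ltac:(lia) (root1 q ltac:(lia)).
Qed.

Definition halves : cmd :=
  (Assign vj (Const 1);;
   While (Lt (Var vj) (Var vn))
    (Put aHalf (Add (Var vj) (Var vj)) (Var vj);;
     Put aHalf (Add (Add (Var vj) (Var vj)) (Const 1)) (Var vj);;
     Assign vj (Add (Var vj) (Const 1))))%C.

Lemma run_halves m : var m vn = n ->
  run wle halves m (fun m' tr t =>
    [/\ tr = [::], t <= 4 * n + 2,
        same_arrs [:: aHalf] m m' /\ same_vars [:: vj] m m'
      & forall i, 1 < i < n + n -> arr m' aHalf i = i./2]).
Proof.
move=> nE.
pose I m' (tr : seq (op nat)) p :=
  [/\ tr = [::], p = 4 * (n - var m' vj),
      same_arrs [:: aHalf] m m' /\ same_vars [:: vj] m m',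
      0 < var m' vj
    & forall i, 1 < i < var m' vj + var m' vj -> arr m' aHalf i = i./2].
apply: run_seq; apply: run_assign; apply: run_conseq.
  apply: (run_while (I := I) (tr := [::]) (p := 4 * (n - 1))); last first.
    by split=> //=; [split; frame | lia].
  move=> m1 tr p [-> -> [fa fv] j0 hf] /= jn; rewrite (fv vn isT) nE in jn.
  steps; exists (4 * (n - (var m1 vj).+1)); split; last by lia.
  split=> //=; [by rewrite addn1 | by split; frame | by lia |].
  set j := var m1 vj in jn j0 hf *.
  move=> i; case: eqP => [->|i1]; first lia.
  case: eqP => [->|i2]; first lia.
  by move=> ij; apply: hf; lia.
move=> m' tr t [p' [[/= -> -> [fa fv] j0 hf]]]; rewrite (fv vn isT) nE => jn tp.
split=> //; first lia.
by move=> i i0; apply: hf; lia.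
Qed.

Definition build_heap : cmd :=
  (Assign vj (Var vn);;
   While (Lt (Var vj) (Add (Var vn) (Var vn)))
    (Put aT (Var vj) (Var vj);;
     Assign vi (Var vj);;
     sift;;
     Assign vj (Add (Var vj) (Const 1))))%C.

(** The leaves are filled one at a time, each followed by a sift; the initial all-zero tree is
    correct, as all its leaves are empty. *)
Lemma run_build_heap m : var m vn = n -> arr m aEL = el ->
  (forall i, 1 < i < n + n -> arr m aHalf i = i./2) ->
  (forall i, arr m aT i = 0) ->
  run wle build_heap m (fun m' tr t =>
    [/\ tr = [::], t <= n * (7 * trunc_log 2 (n + n) + 5) + 2,
        same_arrs [:: aT] m m' /\ same_vars [:: vj; vi; va; vb] m m',
        forall i, 0 < i < n -> heap_at (arr m' aT) i
      & forall p, n <= p < n + n -> arr m' aT p = p]).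
Proof.
move=> nE elE halfE t0.
pose B := 7 * trunc_log 2 (n + n) + 5.
pose I m' (tr : seq (op nat)) p :=
  [/\ tr = [::], p = (n + n - var m' vj) * B /\ n <= var m' vj,
        same_arrs [:: aT] m m' /\ same_vars [:: vj; vi; va; vb] m m',
        forall i, 0 < i < n -> heap_at (arr m' aT) i
      & forall p, n <= p -> arr m' aT p = if p < var m' vj then p else 0].
apply: run_seq; apply: run_assign; apply: run_conseq.
  apply: (run_while (I := I) (tr := [::]) (p := (n + n - n) * B)); last first.
    split=> //=; first by rewrite nE.
    - by split; frame.
    - by move=> i _; rewrite /heap_at /win /= !t0 /better /=.
    - by move=> p pn; rewrite t0 nE; case: ltnP => //; lia.
  move=> m1 tr p [-> [-> jn] [fa fv] hp lf] /= jn2; rewrite (fv vn isT) nE in jn2.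
  set j := var m1 vj in jn jn2 lf *.
  apply: run_seq; apply: run_put; apply: run_seq; apply: run_assign => /=; rewrite -/j.
  apply: run_seq; apply: run_conseq.
    apply: run_sift => /=.
    - by rewrite fa.
    - lia.
    - by rewrite fa.
    - move=> i i0 ij; rewrite /heap_at; do !(case: eqP; first by lia).
      by move=> _ _ _; apply: hp.
  move=> m2 tr2 t2 /= [-> tm [fa2 fv2] hp2 lf2].
  step => /=; exists ((n + n - j.+1) * B).
  have j2E : var m2 vj = j by rewrite fv2.
  split.
    split=> //=; rewrite j2E ?addn1; first by split=> //; lia.
    - split; frame.
        by apply: same_arrs_trans fa2 => //; frame.
      by apply: same_vars_trans fv2 => //; frame.
    - move=> q qn; rewrite lf2 //= ; case: eqP => [->|/eqP qj]; first by rewrite ltnSn.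
      by rewrite lf // ltnS [q <= j]leq_eqVlt (negbTE qj).
  have := leq_trunc_log 2 (_ : j <= n + n) => /(_ ltac:(lia)).
  rewrite (_ : n + n - j = (n + n - j.+1).+1); last lia.
  rewrite mulSn /B; lia.
move=> m' tr t [p' [[/= -> [-> jn] [fa fv] hp lf]]]; rewrite (fv vn isT) nE => jn2 tp.
split=> //; first by rewrite addnK in tp; move: tp; rewrite -/B; lia.
by move=> p pn; rewrite lf ?ifT //; lia.
Qed.

End Heap.

(** * Peeling leaves *)

(* The edges of both forests are named by the slots n <= j < n + n, which are also
   the leaves of the tournament tree; slot j holds the edge number el j and joins
   the vertices u j and w j. *)
Section Peel.
Variables (wle : rel nat) (n : nat) (u w el : nat -> nat).

Definition inc x := [pred j | (u j == x) || (w j == x)].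

(** Vertex [x] of forest [s], with 0 for the source and 1 for the target, becomes [x + x + s], so
    that a single pass peels both forests on disjoint sets of vertices. *)
Definition load : cmd :=
  (Assign vn (Add (Var vk) (Var vk'));;
   Assign vj (Var vn);;
   While (Lt (Var vj) (Add (Var vn) (Var vn)))
    (If (Lt (Var vj) (Add (Var vn) (Var vk)))
       (Assign ve (Get aF (Defs.Sub (Var vj) (Var vn)));; Assign vs (Const 0))
       (Assign ve (Get aF' (Defs.Sub (Defs.Sub (Var vj) (Var vn)) (Var vk)));; Assign vs (Const 1));;
     Put aEL (Var vj) (Var ve);;
     Assign va (Add (Add (Get aE1 (Var ve)) (Get aE1 (Var ve))) (Var vs));;
     Assign vb (Add (Add (Get aE2 (Var ve)) (Get aE2 (Var ve))) (Var vs));;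
     Put aU (Var vj) (Var va);;
     Put aW (Var vj) (Var vb);;
     Put aDeg (Var va) (Add (Get aDeg (Var va)) (Const 1));;
     Put aSum (Var va) (Add (Get aSum (Var va)) (Var vj));;
     Put aDeg (Var vb) (Add (Get aDeg (Var vb)) (Const 1));;
     Put aSum (Var vb) (Add (Get aSum (Var vb)) (Var vj));;
     Assign vj (Add (Var vj) (Const 1))))%C.

Hypothesis uw : forall j, n <= j < n + n -> u j != w j.

Lemma run_load m k : n = var m vk + var m vk' -> k = var m vk ->
  (forall j, n <= j < n + n ->
    [/\ el j = if j < n + k then arr m aF (j - n) else arr m aF' (j - n - k),
        u j = arr m aE1 (el j) + arr m aE1 (el j) + (n + k <= j)
      & w j = arr m aE2 (el j) + arr m aE2 (el j) + (n + k <= j)]) ->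
  (forall x, arr m aDeg x = 0) -> (forall x, arr m aSum x = 0) ->
  run wle load m (fun m' tr t =>
    [/\ tr = [::] /\ t <= 14 * n + 3,
        same_arrs [:: aEL; aU; aW; aDeg; aSum] m m' /\
          same_vars [:: vn; vj; ve; vs; va; vb] m m',
        var m' vn = n,
        forall j, n <= j < n + n ->
          [/\ arr m' aEL j = el j, arr m' aU j = u j & arr m' aW j = w j]
      & forall x, arr m' aDeg x = count (inc x) (iota n n) /\
          arr m' aSum x = sumn [seq j <- iota n n | inc x j]]).
Proof.
move=> nE kE slot d0 s0.
pose I m' (tr : seq (op nat)) p :=
  [/\ [/\ tr = [::], p = (n + n - var m' vj) * 14 & n <= var m' vj <= n + n],
        same_arrs [:: aEL; aU; aW; aDeg; aSum] m m' /\
          same_vars [:: vn; vj; ve; vs; va; vb] m m',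
        var m' vn = n,
        forall j, n <= j < var m' vj ->
          [/\ arr m' aEL j = el j, arr m' aU j = u j & arr m' aW j = w j]
      & forall x, arr m' aDeg x = count (inc x) (iota n (var m' vj - n)) /\
          arr m' aSum x = sumn [seq j <- iota n (var m' vj - n) | inc x j]].
do 2!(apply: run_seq; apply: run_assign); apply: run_conseq.
  apply: (run_while (I := I) (tr := [::]) (p := (n + n - n) * 14)); last first.
    split=> //=; rewrite -?nE; first by split=> //; lia.
    - by split; frame.
    - by move=> j; lia.
    - by move=> x; rewrite subnn /=.
  move=> m1 tr p [[-> -> jn] [fa fv] nE1 sl dg] /= jn2; rewrite nE1 in jn2.
  set j := var m1 vj in jn jn2 sl dg *.
  have [elE uE wE] := slot j ltac:(lia).
  have uwj : u j != w j by apply: uw; lia.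
  apply: run_seq; set Q := (X in run _ _ _ X).
  (* The remainder of the loop body, common to both branches of the conditional; these take at most
     3 steps to set [ve] and [vs]. *)
  have rest m2 t2 : t2 <= 3 -> var m2 ve = el j -> var m2 vs = (n + k <= j) ->
      m2 = set_var (set_var m1 ve (el j)) vs (n + k <= j) -> Q m2 [::] t2.
    move=> t23 eE sE m2E; rewrite /Q.
    have -> : m2 = set_var (set_var m1 ve (el j)) vs (n + k <= j) by [].
    steps; rewrite /= -/j; exists ((n + n - j.+1) * 14); split; last first.
      rewrite (_ : n + n - j = (n + n - j.+1).+1); last lia.
      rewrite mulSn; lia.
    rewrite (fa aE1 isT) (fa aE2 isT) -uE -wE (addn1 j).
    split=> //=; first by split=> //; lia.
    - by split; frame.
    - move=> i ij; case: eqP => [->|/eqP iNj] //; apply: sl; lia.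
    rewrite subSn; last by lia.
    have -> : iota n (j - n).+1 = iota n (j - n) ++ [:: j].
      by rewrite -addn1 iotaD /= subnKC //; lia.
    move=> x; rewrite count_cat filter_cat sumn_cat.
    have [<- <-] := dg x; rewrite /= (eq_sym x) (eq_sym x).
    have wuj : (w j == u j) = false by rewrite eq_sym (negbTE uwj).
    rewrite wuj; have [<-|wx] := eqVneq (w j) x.
      by rewrite eq_sym wuj /= !addn0.
    by have [<-|ux] := eqVneq (u j) x; rewrite /= !addn0.
  have kE1 : var m1 vk = k by rewrite (fv vk isT).
  apply: run_if => /=; rewrite -/j nE1 kE1 => jk; steps; rewrite /= -/j nE1 ?kE1.
    have jk2 : (n + k <= j) = false by lia.
    have eE : arr m1 aF (j - n) = el j by rewrite (fa aF isT) elE ifT //; lia.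
    by rewrite eE; apply: rest; rewrite ?jk2.
  have jk2 : (n + k <= j) = true by lia.
  have eE : arr m1 aF' (j - n - k) = el j by rewrite (fa aF' isT) elE ifN //; lia.
  by rewrite eE; apply: rest; rewrite ?jk2.
move=> m' tr t [p' [[/= [-> -> jn] [fa fv] nE1 sl dg]]]; rewrite nE1 => jn2 tp.
have jE : var m' vj = n + n by lia.
split=> //; first by split=> //; lia.
  by rewrite -jE.
by move=> x; rewrite -{2 4}(addKn n n) -jE.
Qed.

(* The vertices without a rank are those not peeled off yet; at the end these are
   the roots, of rank 0. *)
Definition peeled (rk par : nat -> nat) (R : seq nat) :=
  [/\ uniq R /\ {subset R <= iota n n},
      forall x, rk x = 0 \/ size R < rk x /\ count (inc x) R = 0,
      forall j, n <= j < n + n -> j \notin R ->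
        exists x, [/\ inc x j, 0 < rk x & par x = el j]
    & forall x, 0 < rk x -> exists j y, [/\ n <= j < n + n,
        (u j = x /\ w j = y) \/ (u j = y /\ w j = x), par x = el j & rk y < rk x]].

Definition degrees (deg sum : nat -> nat) (R : seq nat) :=
  forall x, deg x = count (inc x) R /\ sum x = sumn [seq j <- R | inc x j].

Lemma count1_filter (T : eqType) (a : pred T) s : count a s = 1 ->
  exists x, [/\ x \in s, a x & [seq y <- s | a y] = [:: x]].
Proof.
rewrite -size_filter; case E: [seq y <- s | a y] => [|x [|]] // _.
exists x; split=> //.
  by have : x \in [:: x] := mem_head _ _; rewrite -E mem_filter => /andP[].
by have : x \in [:: x] := mem_head _ _; rewrite -E mem_filter => /andP[].
Qed.

Lemma sumn_filter_perm (a : pred nat) s s' : perm_eq s s' ->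
  sumn [seq x <- s | a x] = sumn [seq x <- s' | a x].
Proof. by move=> /(perm_filter a)/perm_sumn. Qed.

(** A leaf [v] has one slot left, hence [sum v] is that slot and [b] its other end. The rank
    [size R] is below all ranks given before and above all those given later, so parents, being
    peeled later or never, have smaller ranks. *)
Lemma peel_step rk par deg sum R v : peeled rk par R -> degrees deg sum R ->
  deg v = 1 ->
  let j := sum v in let b := u j + w j - v in let R' := rem j R in
  [/\ j \in R /\ size R = (size R').+1, b != v /\ (inc v j /\ inc b j),
      forall x, count (inc x) R = (x == v) + (x == b) + count (inc x) R',
      peeled (fun x => if x == v then size R else rk x)
             (fun x => if x == v then el j else par x) R'
    & degrees (fun x => if x == b then deg b - 1 else if x == v then 0 else deg x)
              (fun x => if x == b then sum b - j else if x == v then 0 else sum x) R'].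
Proof.
move=> [[uR sR] rkR jR xR] dg dv /=.
have [degv sumv] := dg v; rewrite dv in degv.
have [j [jinR vj fj]] := count1_filter (esym degv).
have -> : sum v = j by rewrite sumv fj /= addn0.
have jn : n <= j < n + n by move: (sR _ jinR); rewrite mem_iota.
set b := u j + w j - v; set R' := rem j R.
have pR : perm_eq R (j :: R') := perm_to_rem jinR.
have uwj := uw jn.
have vb : (u j = v /\ w j = b) \/ (u j = b /\ w j = v).
  by case/orP: vj => /eqP h; [left | right]; rewrite /b -h; lia.
have bv : b != v by case: vb uwj => [[-> ->]|[-> ->]] //; rewrite eq_sym.
have incj x : inc x j = (x == v) || (x == b) :> bool.
  by case: vb => -[/= -> ->]; rewrite !(eq_sym x) // orbC.
have cntE x : count (inc x) R = (x == v) + (x == b) + count (inc x) R'.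
  have /permP/(_ (inc x)) -> := pR; rewrite /= -[_ || _]/(inc x j) incj.
  by case: eqVneq => // ->; rewrite eq_sym (negbTE bv).
have szR : size R = (size R').+1 by rewrite (perm_size pR).
have cv : count (inc v) R' = 0 by have := cntE v; rewrite -degv eqxx; lia.
have rkv : rk v = 0 by case: (rkR v) => // -[_]; rewrite -degv.
have rkb : rk b = 0.
  by case: (rkR b) => // -[_]; rewrite cntE eqxx; lia.
have sumE x : sumn [seq i <- R | inc x i] =
    (if (x == v) || (x == b) then j else 0) + sumn [seq i <- R' | inc x i].
  by rewrite (sumn_filter_perm _ pR) /= -[_ || _]/(inc x j : bool) incj; case: ifP.
have dgs : degrees (fun x => if x == b then deg b - 1 else if x == v then 0 else deg x)
    (fun x => if x == b then sum b - j else if x == v then 0 else sum x) R'.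
  move=> x; have [dx sx] := dg x; rewrite cntE in dx; rewrite sumE in sx.
  have [->|xb] := eqVneq x b.
    have [db sb] := dg b; rewrite db sb cntE sumE eqxx (negbTE bv) /=.
    by rewrite addKn; split=> //; lia.
  have [->|xv] := eqVneq x v; last by rewrite dx sx (negbTE xv) (negbTE xb).
  rewrite cv; split=> //; have : size [seq i <- R' | inc v i] = 0 by rewrite size_filter.
  by move/size0nil ->.
have ivb : inc v j /\ inc b j by rewrite !incj !eqxx orbT.
split=> //; split.
- by split; [apply: rem_uniq | move=> x /mem_rem/sR].
- move=> x; case: eqVneq => [->|xv]; first by right; rewrite szR.
  case: (rkR x) => [|[h1 h2]]; first by left.
  by right; split; [rewrite szR in h1; apply: ltnW | move: h2; rewrite cntE; lia].
- move=> i iN; have [->|ij] := eqVneq i j => iR.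
    by exists v; rewrite eqxx szR; split=> //; case: ivb.
  have iR2 : i \notin R by apply: contra iR => iR; rewrite /R' mem_rem_uniq // inE ij.
  have [x [xi rkx px]] := jR i iN iR2; exists x.
  have xv : x != v by apply: contraTneq rkx => ->; rewrite rkv.
  by rewrite (negbTE xv).
move=> x; case: (eqVneq x v) => [-> _|xv rkx].
  by exists j, b; split=> //; rewrite (negbTE bv) rkb szR.
have [i [y [iN xy px rkyx]]] := xR x rkx.
exists i, y; split=> //; case: ifP => // /eqP yv.
by case: (rkR x) => [h|[]] //; rewrite h in rkx.
Qed.

(** Removing a leaf may turn its only neighbour into a leaf, with which the loop goes on. The rank
    counter [vc] equals the number of slots left. *)
Definition chain : cmd :=
  (While (Eq (Get aDeg (Var va)) (Const 1))
    (Assign vi (Get aSum (Var va));;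
     Put aPar (Var va) (Get aEL (Var vi));;
     Put aRk (Var va) (Var vc);;
     Assign vc (Defs.Sub (Var vc) (Const 1));;
     Put aDeg (Var va) (Const 0);;
     Put aSum (Var va) (Const 0);;
     Assign vb (Defs.Sub (Add (Get aU (Var vi)) (Get aW (Var vi))) (Var va));;
     Put aDeg (Var vb) (Defs.Sub (Get aDeg (Var vb)) (Const 1));;
     Put aSum (Var vb) (Defs.Sub (Get aSum (Var vb)) (Var vi));;
     Assign va (Var vb)))%C.

Definition peel_arrs := [:: aDeg; aSum; aRk; aPar].
Definition chain_vars := [:: vi; vc; va; vb].

Definition slots_ok m := forall j, n <= j < n + n ->
  [/\ arr m aEL j = el j, arr m aU j = u j & arr m aW j = w j].

Lemma slots_ok_frame m m' : same_arrs peel_arrs m m' -> slots_ok m -> slots_ok m'.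
Proof.
by move=> fa sl j jn; rewrite (fa aEL isT) (fa aU isT) (fa aW isT); apply: sl.
Qed.

Definition peeling m R :=
  [/\ peeled (arr m aRk) (arr m aPar) R, degrees (arr m aDeg) (arr m aSum) R
    & var m vc = size R].

(** [Z] collects vertices known not to be leaves, apart from the current one. A round lowers only
    the degrees of the leaf, which drops to 0, and of its neighbour, which becomes the current
    vertex. The time is charged to the removed slots. *)
Lemma run_chain m R (Z : pred nat) : slots_ok m -> peeling m R ->
  (forall x, Z x -> x != var m va -> count (inc x) R != 1) ->
  run wle chain m (fun m' tr t => exists R',
    [/\ tr = [::] /\ t + 11 * size R' <= 11 * size R + 1,
        same_arrs peel_arrs m m' /\ same_vars chain_vars m m',
        peeling m' R'
      & forall x, Z x -> count (inc x) R' != 1]).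
Proof.
move=> sl pe ZR.
pose I m' (tr : seq (op nat)) p := exists R',
  [/\ tr = [::] /\ p = 11 * size R',
        same_arrs peel_arrs m m' /\ same_vars chain_vars m m',
        peeling m' R'
      & forall x, Z x -> x != var m' va -> count (inc x) R' != 1].
apply: run_conseq.
  apply: (run_while (I := I) (tr := [::]) (p := 11 * size R)); last by exists R.
  move=> m1 tr p [R1 [[-> ->] [fa fv] [pe1 dg1 c1] ZR1]] /= d1.
  set v := var m1 va in d1 ZR1 *.
  have dv : arr m1 aDeg v = 1 by apply/eqP; rewrite eqn_leq.
  have [[jR szR] [bv _] cntE pe2 dg2] := peel_step pe1 dg1 dv.
  set j := arr m1 aSum v in jR szR bv cntE pe2 dg2 *.
  have jn : n <= j < n + n.
    by case: pe1 => -[_ /(_ _ jR)]; rewrite mem_iota.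
  have [elE uE wE] := sl j jn.
  steps; rewrite /= -/v -/j c1 (fa aEL isT) (fa aU isT) (fa aW isT) elE uE wE.
  set b := u j + w j - v in bv cntE pe2 dg2 *.
  rewrite (negbTE bv); exists (11 * size (rem j R1)); split; last by rewrite szR; lia.
  exists (rem j R1); split=> //=.
  - by split; rewrite /peel_arrs /chain_vars; frame.
  - by split=> //=; rewrite szR subn1.
  move=> x Zx xb; have := cntE x; rewrite (negbTE xb) addn0.
  have [-> |xv] := eqVneq x v; last by rewrite add0n => <-; apply: ZR1.
  by have [dv1 _] := dg1 v; rewrite -dv1 dv; lia.
move=> m' tr t [p' [[R' [[/= -> ->] fr [pe' dg' c'] ZR']] /= nd tp]].
exists R'; split=> //; first by split=> //; lia.
move=> x Zx; have [->|] := eqVneq x (var m' va); last exact: ZR'.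
by have [<- _] := dg' (var m' va); move: nd; rewrite -eqn_leq.
Qed.

Definition peel : cmd :=
  (Assign vc (Var vn);; Assign vj (Var vn);;
   While (Lt (Var vj) (Add (Var vn) (Var vn)))
    (Assign va (Get aU (Var vj));;
     chain;;
     Assign va (Get aW (Var vj));;
     chain;;
     Assign vj (Add (Var vj) (Const 1))))%C.

(** After the scan no end of any slot is a leaf. As every nonempty set of slots has a leaf, no slot
    is left over. *)
Lemma run_peel m :
  (forall R, uniq R -> {subset R <= iota n n} -> R != [::] ->
     exists x, count (inc x) R = 1) ->
  var m vn = n -> slots_ok m ->
  (forall x, arr m aRk x = 0) -> degrees (arr m aDeg) (arr m aSum) (iota n n) ->
  run wle peel m (fun m' tr t =>
    [/\ tr = [::] /\ t <= 18 * n + 3,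
        same_arrs peel_arrs m m' /\ same_vars (vj :: chain_vars) m m'
      & peeled (arr m' aRk) (arr m' aPar) [::]]).
Proof.
move=> leaf nE sl rk0 dg.
pose Z i : pred nat := fun x => has (inc x) (iota n (i - n)).
pose I m' (tr : seq (op nat)) p := exists R',
  [/\ tr = [::] /\ p = 11 * size R' + 6 * (n + n - var m' vj),
        same_arrs peel_arrs m m' /\ same_vars (vj :: chain_vars) m m',
        n <= var m' vj <= n + n,
        peeling m' R'
      & forall x, Z (var m' vj) x -> count (inc x) R' != 1].
do 2!(apply: run_seq; apply: run_assign); apply: run_conseq.
  apply: (run_while (I := I) (tr := [::]) (p := 11 * n + 6 * (n + n - n))); last first.
    exists (iota n n); split=> //=; first by rewrite size_iota nE.
    - by split; rewrite /peel_arrs /chain_vars; frame.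
    - by rewrite nE; lia.
    - split=> //=; last by rewrite size_iota.
      split; first by rewrite iota_uniq; split.
      + by left.
      + by move=> j jn; rewrite mem_iota jn.
      + by move=> x; rewrite rk0.
    by move=> x; rewrite /Z nE subnn.
  move=> m1 tr p [R1 [[-> ->] [fa fv] jn pe1 Z1]] /= jn2.
  rewrite (fv vn isT) nE in jn2.
  set j := var m1 vj in jn jn2 Z1 *.
  have [elE uE wE] := sl j ltac:(lia).
  step; step; rewrite /= -/j (fa aU isT) uE.
  step; apply: run_conseq.
    apply: (run_chain (R := R1) (Z := predU1 (u j) (Z j))).
    - exact: slots_ok_frame fa sl.
    - exact: pe1.
    - by move=> x /= /orP[->//|/Z1].
  move=> m2 tr2 t2 [R2 [[-> t2R] [fa2 fv2] pe2 Z2]].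
  have j2E : var m2 vj = j by rewrite (fv2 vj isT).
  step; step; rewrite /= j2E (fa2 aW isT) /= (fa aW isT) wE.
  step; apply: run_conseq.
    apply: (run_chain (R := R2) (Z := predU1 (w j) (predU1 (u j) (Z j)))).
    - exact: slots_ok_frame fa2 (slots_ok_frame fa sl).
    - exact: pe2.
    - by move=> x /= /orP[->//|/Z2].
  move=> m3 tr3 t3 [R3 [[-> t3R] [fa3 fv3] pe3 Z3]].
  have j3E : var m3 vj = j by rewrite (fv3 vj isT).
  step; rewrite /= j3E addn1; exists (11 * size R3 + 6 * (n + n - j.+1)); split; last by lia.
  exists R3; split=> //=.
  - split.
      frame; apply: (same_arrs_trans _ _ fa3) => //; frame.
      by apply: (same_arrs_trans _ _ fa2) => //; frame.
    frame; apply: (same_vars_trans _ _ fv3) => //; frame.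
    by apply: (same_vars_trans _ _ fv2) => //; frame.
  - lia.
  move=> x; rewrite /Z subSn; last by lia.
  rewrite -addn1 iotaD has_cat subnKC; last by lia.
  rewrite /= orbF => /orP[zj|/orP[]/eqP <-]; apply: Z3; rewrite /= ?eqxx ?orbT //.
  by rewrite /Z zj !orbT.
move=> m' tr t [p' [[R [[/= -> ->] [fa fv] jn [pe' dg' c'] ZR]]]].
rewrite (fv vn isT) nE => jn2 tp.
have jE : var m' vj = n + n by lia.
have R0 : R = [::].
  case: pe' => -[uR sR] _ _ _; apply/eqP/negPn/negP => /(leaf R uR sR)[x cx].
  suff zx : Z (var m' vj) x by have := ZR x zx; rewrite cx.
  rewrite jE /Z addKn.
  have : has (inc x) R by rewrite has_count cx.
  by case/hasP=> i /sR iR ix; apply/hasP; exists i.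
by split=> //; [split=> //; lia | rewrite -R0].
Qed.

End Peel.

(** * Union by size *)

Section UnionFind.
Variables (wle : rel nat) (V : finType) (nu : V -> nat).
Hypothesis nu_inj : injective nu.

Definition cls (rt : V -> V) v := [set x | rt x == v].

Lemma in_cls rt v x : (x \in cls rt v) = (rt x == v).
Proof. by rewrite inE. Qed.

(* In array up, 0 marks a root and p.+1 a vertex with parent p; array sz stores
   the size of the class of each root, minus 1: both are correct initially. *)
Definition union_find (up sz : nat -> nat) (rt : V -> V) (dp : V -> nat) :=
  [/\ forall v, [/\ up (nu v) = 0, rt v = v & dp v = 0] \/
        (exists u, [/\ up (nu v) = (nu u).+1, rt u = rt v & dp v = (dp u).+1]),
      forall v, 2 ^ dp v <= #|cls rt (rt v)|
    & forall v, rt v = v -> (sz (nu v)).+1 = #|cls rt v|].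

Definition find_root x : cmd :=
  While (Leq (Const 1) (Get aUp (Var x)))
    (Assign x (Defs.Sub (Get aUp (Var x)) (Const 1))).

Section State.
Variables (up sz : nat -> nat) (rt : V -> V) (dp : V -> nat).
Hypothesis uf : union_find up sz rt dp.

Lemma uf_root v : up (nu (rt v)) = 0 /\ rt (rt v) = rt v.
Proof.
case: uf => par _ _; have [d] := ubnP (dp v); elim: d => // d IH in v *.
case: (par v) => [[upv rv _]|[u [_ <- dv]]]; first by rewrite !rv.
by move=> lt; apply: IH; lia.
Qed.

Lemma uf_dp_root v : rt v = v -> dp v = 0.
Proof.
case: uf => par _ _ rv; case: (par v) => [[]|[u [upv _ _]]] //.
by have [] := uf_root v; rewrite rv upv.
Qed.

(** The class of [v] contains a single root, so its size is at most one more than the number of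
    non-roots. This makes the depth logarithmic in the number of unions, whatever the number of
    vertices of the graph. *)
Lemma uf_depth v : dp v <= trunc_log 2 #|[set x | rt x != x]|.+1.
Proof.
case: uf => _ sz2 _; have := leq_trunc_log 2 (sz2 v); rewrite trunc_expnK // => h.
apply: leq_trans h _; apply: leq_trunc_log.
rewrite (cardsD1 (rt v)) in_cls (uf_root v).2 eqxx add1n ltnS; apply: subset_leq_card.
apply/subsetP=> x; rewrite in_setD1 in_cls inE => /andP[xN /eqP xv].
by rewrite xv eq_sym.
Qed.

Lemma run_find m x v : arr m aUp = up -> var m x = nu v ->
  run wle (find_root x) m (fun m' tr t =>
    [/\ tr = [::], t <= 2 * dp v + 1, same_arrs [::] m m',
        same_vars [:: x] m m' & var m' x = nu (rt v)]).
Proof.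
case: uf => par _ _ upE xv.
pose I m' (tr : seq (op nat)) p := exists v',
  [/\ tr = [::], p = 2 * dp v' & same_arrs [::] m m'] /\
  [/\ same_vars [:: x] m m', var m' x = nu v' & rt v' = rt v].
apply: run_conseq.
  apply: (run_while (I := I) (tr := [::]) (p := 2 * dp v)); last by exists v.
  move=> m1 tr p [v1 [[-> -> fa] [fv xv1 rv1]]] /=.
  rewrite xv1 (fa aUp isT) upE; case: (par v1) => [[-> //]|[u [uE ru ->]] _].
  step; rewrite /= xv1 (fa aUp isT) upE uE subn1 /=; exists (2 * dp u); split; last by lia.
  by exists u; split; split; rewrite /= ?eqxx ?ru //; frame; rewrite inE.
move=> m' tr t [p' [[v' [[/= -> -> fa] [fv xv' rv']]]]].
rewrite /= xv' (fa aUp isT) upE; case: (par v') => [[_ rv d0 _]|[u [-> //]]].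
by rewrite -rv' -rv; split=> //; rewrite ?rv //; lia.
Qed.

Section Union.
Variables (A B : V).
Hypotheses (rA : rt A = A) (rB : rt B = B) (AB : A != B).
Hypothesis szBA : sz (nu B) <= sz (nu A).

Definition union_rt := fun x => if rt x == B then A else rt x.
Definition union_dp := fun x => if rt x == B then (dp x).+1 else dp x.

Lemma union_rtP x y : (rt x = rt y -> union_rt x = union_rt y) /\
  (union_rt x = union_rt y ->
   rt x = rt y \/ (rt x \in [:: A; B]) && (rt y \in [:: A; B])).
Proof.
rewrite /union_rt; split; first by move->.
rewrite !inE; case: (eqVneq (rt x) B) => [->|xB]; case: (eqVneq (rt y) B) => [->|yB].
- by left.
- by move=> <-; right; rewrite !eqxx orbT.
- by move=> ->; right; rewrite !eqxx orbT.
- by left.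
Qed.

Lemma cls_union v : cls union_rt v =
  if v == A then cls rt A :|: cls rt B else if v == B then set0 else cls rt v.
Proof.
have cU v1 x : (x \in cls union_rt v1) = ((if rt x == B then A else rt x) == v1).
  by rewrite in_cls.
apply/setP=> x; rewrite cU; have [->|vA] := eqVneq v A.
  by rewrite in_setU !in_cls; case: (eqVneq (rt x) B); rewrite ?eqxx ?orbT ?orbF.
have [->|vB] := eqVneq v B; first by rewrite in_set0; case: (eqVneq (rt x) B) => [_|h]; apply/negbTE.
rewrite in_cls; case: (eqVneq (rt x) B) => // ->.
by rewrite !(eq_sym _ v) (negbTE vA) (negbTE vB).
Qed.

Lemma card_cls_union : #|cls rt A :|: cls rt B| = #|cls rt A| + #|cls rt B|.
Proof.
apply/eqP; rewrite (leq_card_setU _ _).2; apply/pred0P=> x /=.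
by rewrite !in_cls; apply/negP=> /andP[/eqP->]; apply/negP.
Qed.

(** Depths grow by one only in the class of [B], which is not the larger one, so the merged class is
    at least twice as large. The added 1 in the new size comes from storing sizes minus 1. *)
Lemma union_findU :
  union_find (fun j => if j == nu B then (nu A).+1 else up j)
    (fun j => if j == nu A then sz (nu A) + sz (nu B) + 1 else sz j)
    union_rt union_dp.
Proof.
case: uf => par sz2 szE; have szA := szE A rA; have szB := szE B rB.
have rt'A : union_rt A = A by rewrite /union_rt rA (negbTE AB).
have dA : dp A = 0 := uf_dp_root rA.
split.
- move=> v; rewrite (inj_eq nu_inj); have [->|vB] := eqVneq v B.
    right; exists A; rewrite rt'A /union_rt /union_dp rA rB eqxx (negbTE AB).
    by rewrite dA (uf_dp_root rB).
  case: (par v) => [[upv rv dv]|[u [upv ru dv]]].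
    by left; rewrite /union_rt /union_dp rv (negbTE vB).
  by right; exists u; rewrite /union_rt /union_dp ru upv dv; case: eqP.
- move=> v; rewrite cls_union /union_rt /union_dp.
  have [rvB|rvB] := eqVneq (rt v) B.
    rewrite eqxx card_cls_union -szA; have := sz2 v; rewrite rvB -szB expnS; lia.
  have [rvA|rvA] := eqVneq (rt v) A.
    by rewrite card_cls_union; apply: leq_trans (leq_addr _ _); rewrite -rvA.
  by rewrite (negbTE rvB).
move=> v; rewrite (inj_eq nu_inj) cls_union /union_rt.
have [->|vA] := eqVneq v A; first by rewrite card_cls_union -szA -szB => _; lia.
have [->|vB] := eqVneq v B; first by rewrite rB eqxx => h; case/eqP: AB.
case: eqP => [_ h|_]; first by rewrite h eqxx in vA.
exact: szE.
Qed.

Lemma card_nonroot_union :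
  #|[set x | union_rt x != x]| = #|[set x | rt x != x]|.+1.
Proof.
rewrite (cardsD1 B) inE /union_rt rB eqxx AB add1n; congr _.+1.
apply: eq_card => x; rewrite !inE; have [->|xB] := eqVneq x B; first by rewrite rB eqxx.
have [rxB|] //= := eqVneq (rt x) B.
rewrite rxB eq_sym (eq_sym B) xB; apply/negP=> /eqP xA.
by case/eqP: AB; rewrite -rxB xA rA.
Qed.

End Union.
End State.

Lemma union_find_init up sz : (forall i, up i = 0) -> (forall i, sz i = 0) ->
  union_find up sz id (fun=> 0).
Proof.
have c1 v : cls id v = [set v] by apply/setP=> x; rewrite !inE.
by move=> u0 s0; split=> v; rewrite ?c1 ?cards1 ?s0 //; left.
Qed.

End UnionFind.

(** * Exchanges on the two rooted forests *)

Section Side.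
Variables (wle : rel nat) (R : realDomainType) (V : finType) (E : {set {set V}}).
Variables (w : {set V} -> R) (nu : V -> nat) (en : {set V} -> nat).
Hypotheses (nu_inj : injective nu) (sE : simple_graph E).
Variables (Fs : bool -> {set {set V}}) (rk : bool -> V -> nat).
Variables (pe : bool -> V -> {set V}) (pv : bool -> V -> V).
Hypothesis rF : forall s, rooting (rk s) (pe s) (pv s) (Fs s).

(* The rooted forests F (s = false) and F' (s = true) are stored together, as a
   forest on two copies of the vertices. *)
Definition dbl (s : bool) v := nu v + nu v + s.

Lemma dbl_inj s t u v : dbl s u = dbl t v -> s = t /\ u = v.
Proof.
rewrite /dbl => h; have st : s = t by case: s t h => [] [] //; lia.
by split=> //; apply: nu_inj; move: h; rewrite st; lia.
Qed.

(* At a root of the union-find structure, the arrays of ranks and of parent edges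
   are overwritten with the values at the vertex of minimal rank in its class. *)
Definition side (s : bool) (rt : V -> V) (N : {set {set V}}) (rka para : nat -> nat)
    (rep : V -> V) (S : {set {set V}}) :=
  [/\ hybrid (rk s) (pe s) rt rep N S, spanning_forest E S,
      (weight w S <= weight w (Fs s))%R
    & forall v, rt v = v -> rka (dbl s v) = rk s (rep v) /\
        (0 < rk s (rep v) -> para (dbl s v) = en (pe s (rep v)))].

(** The representative of larger rank, that of [vb] in a tie, gives up its parent edge, whose number
    goes to [vf]. Since [va] is the root of the merged class, its entries must then describe the
    surviving representative; they are copied from [vb] exactly when the representative of [va]
    loses. *)
Definition swap_edge (s : bool) : cmd :=
  let a := Add (Add (Var va) (Var va)) (Const s) in
  let b := Add (Add (Var vb) (Var vb)) (Const s) in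
  (If (Leq (Get aRk a) (Get aRk b))
     (Assign vf (Get aPar b))
     (Assign vf (Get aPar a);; Put aPar a (Get aPar b);; Put aRk a (Get aRk b)))%C.

Section Step.
Variables (s : bool) (rt rt' : V -> V) (N S : {set {set V}}) (rka para : nat -> nat).
Variables (rep : V -> V).
Hypothesis hS : side s rt N rka para rep S.

(** The deleted edge leads from a representative to its parent, hence between two classes; by the
    hypothesis on [Fs s] it cannot be lighter than the new edge, so the weight does not increase. *)
Lemma side_step a b : [set a; b] \in E -> rt a != rt b ->
  rk s (rep b) <= rk s (rep a) ->
  (forall f, f \in Fs s -> (w [set a; b] <= w f)%R \/
     (forall x y, f = [set x; y] -> rt x = rt y)) ->
  (forall x y, rt x = rt y -> rt' x = rt' y) -> rt' a = rt' b ->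
  (forall x y, rt' x = rt' y ->
     rt x = rt y \/ (rt x \in [:: rt a; rt b]) && (rt y \in [:: rt a; rt b])) ->
  let f := pe s (rep a) in let S' := [set a; b] |: (S :\ f) in
  [/\ f \in S, [set a; b] \notin S :\ f, 0 < rk s (rep a),
      hybrid (rk s) (pe s) rt' (merge_rep rt rep a b) ([set a; b] |: N) S'
    & spanning_forest E S' /\ (weight w S' <= weight w (Fs s))%R].
Proof.
case: hS => hyb fS wS _ abE rab le Fmin rt1 rt2 rt3 f S'.
have fin := hybrid_pe_in (rF s) hyb fS abE rab le.
have rk0 := hybrid_rk_gt0 (rF s) hyb fS abE rab le.
have nin := hybrid_new_notin (rF s) hyb rab le.
split=> //; first exact: (hybrid_step_hybrid (rF s) hyb fS abE rab le rt1 rt2 rt3).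
split; first exact: (hybrid_step_forest (rF s) hyb sE fS abE rab le).
apply: le_trans wS; apply: weight_exchange => //.
  by move=> abS; apply/eqP; move: nin; rewrite in_setD1 abS andbT negbK.
have fF : f \in Fs s by rewrite (rooting_set (rF s)); apply: imset_f; rewrite inE.
case: (Fmin f fF) => // h; have rr : rep (rep a) = rep a.
  by apply: (hybrid_repc hyb); apply: (hybrid_rep hyb).
have := hybrid_pv_neq (rF s) hyb rk0 rr.
by rewrite (h _ _ (rooting_edge (rF s) rk0)) eqxx.
Qed.

End Step.

(** The last conclusion confines the changes to one entry, so that the data of the other copy of the
    vertices stay valid. *)
Lemma run_swap_edge m s rt N rep S a b (A := rt a) (B := rt b)
    (rt' := union_rt rt A B) :
  side s rt N (arr m aRk) (arr m aPar) rep S ->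
  (forall v, rt (rt v) = rt v) ->
  [set a; b] \in E -> A != B -> var m va = nu A -> var m vb = nu B ->
  (forall f, f \in Fs s -> (w [set a; b] <= w f)%R \/
     (forall x y, f = [set x; y] -> rt x = rt y)) ->
  run wle (swap_edge s) m (fun m' tr t => exists f rep',
    [/\ tr = [::] /\ t <= 4,
        same_arrs [:: aRk; aPar] m m' /\ same_vars [:: vf] m m',
        var m' vf = en f /\ (f \in S /\ [set a; b] \notin S :\ f),
        side s rt' ([set a; b] |: N) (arr m' aRk) (arr m' aPar) rep'
          ([set a; b] |: (S :\ f))
      & forall i, i != dbl s A ->
          arr m' aRk i = arr m aRk i /\ arr m' aPar i = arr m aPar i]).
Proof.
move=> hs rtK abE AB vaE vbE Fmin; have [hyb fS wS ann] := hs.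
have rA : rt A = A := rtK a. have rB : rt B = B := rtK b.
have [rkA parA] := ann A rA; have [rkB parB] := ann B rB.
have repA : rep A = rep a by apply: (hybrid_repc hyb).
have repB : rep B = rep b by apply: (hybrid_repc hyb).
have rtP x y := union_rtP rt A B x y.
have rt'v v : rt' v = v -> v != B /\ (v != A -> rt v = v).
  rewrite /rt' /union_rt; have [rvB|rvB] := eqVneq (rt v) B.
    by move=> <-; split=> //; rewrite eqxx.
  by move=> h; split=> //; apply: contraNneq rvB => h2; rewrite h2 rB.
have rt'ab : rt' a = rt' b.
  by rewrite /rt' /union_rt -/A -/B eqxx (negbTE AB).
rewrite repA in rkA parA; rewrite repB in rkB parB.
apply: run_if => /=; rewrite vaE vbE -/(dbl s A) -/(dbl s B) rkA rkB.
  move=> le; step; rewrite /= vbE -/(dbl s B).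
  (* The representative of [b] loses its edge here, so [side_step] is applied with [a] and [b]
     interchanged. *)
  rewrite setUC in abE Fmin *.
  have [||fin nin rk0 hyb' [f' w']] := side_step (rt' := rt') hs abE _ le Fmin (fun x y => (rtP x y).1) (esym rt'ab).
  - by rewrite eq_sym.
  - move=> x y /(rtP x y).2[]; first by left.
    have mem2 z : (z \in [:: rt b; rt a]) = (z \in [:: rt a; rt b]).
      by rewrite !inE orbC.
    by right; rewrite !mem2.
  exists (pe s (rep b)), (merge_rep rt rep b a); split=> //.
  - by split; frame.
  - by rewrite /= parB.
  split=> // v /rt'v[vB vA]; rewrite /merge_rep -/B /=.
  have [->|vNA] := eqVneq v A; first by rewrite rA (negbTE AB) repA.
  by rewrite vA // (negbTE vB); apply: ann; apply: vA.
rewrite -ltnNge => lt; steps; rewrite /= vaE vbE -/(dbl s A) -/(dbl s B).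
have [|fin nin rk0 hyb' [f' w']] := side_step (rt' := rt') hs abE AB (ltnW lt) Fmin (fun x y => (rtP x y).1) rt'ab.
  by move=> x y /(rtP x y).2.
exists (pe s (rep a)), (merge_rep rt rep a b); split=> //.
- by split; frame.
- by rewrite /= parA.
- split=> // v /rt'v[vB vA]; rewrite /merge_rep -/A /=.
  have [->|vNA] := eqVneq v A; first by rewrite rA !eqxx rkB; split=> // /parB.
  have dN : dbl s v == dbl s A = false.
    by apply/negbTE; apply: contra vNA => /eqP/dbl_inj[_ ->].
  by rewrite dN vA // (negbTE vNA); apply: ann; apply: vA.
by move=> i iN; rewrite /= (negbTE iN).
Qed.

Lemma side_frame s s' rt N rka para rka' para' rep S A :
  side s rt N rka para rep S -> s != s' ->
  (forall i, i != dbl s' A -> rka' i = rka i /\ para' i = para i) ->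
  side s rt N rka' para' rep S.
Proof.
move=> [hyb fS wS ann] ss h; split=> // v rv.
have [|-> ->] := h (dbl s v); last exact: ann.
by apply: contra ss => /eqP/dbl_inj[-> _].
Qed.

End Side.

(** * Kruskal's algorithm *)

Section Gradual.
Variables (V : finType) (E : {set {set V}}) (good : {set {set V}} -> Prop).
Implicit Types (S : {set {set V}}) (e f : {set V}).

Lemma gradual_cat S S1 S2 p1 p2 :
  gradual_transformation E good S S1 p1 -> gradual_transformation E good S1 S2 p2 ->
  gradual_transformation E good S S2 (p1 ++ p2).
Proof.
elim: p1 S => [|[o1 o2] p1 IH] S /=; first by move->.
by case=> l1 l2 g /IH h /h.
Qed.

Lemma gradual_swap S e f : f \in S -> e \in E -> e \notin S :\ f ->
  good (e |: (S :\ f)) ->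
  gradual_transformation E good S (e |: (S :\ f))
    (if f == e then [::] else [:: (Delete f, Insert e)]).
Proof.
move=> fS eE eS g; case: eqP => [<-|_] /=; first by rewrite setD1K.
by split=> //; rewrite inE eS.
Qed.

(** The inverse exchange ends in [S], hence [good] is asked of [S] and not of the exchanged set. *)
Lemma gradual_unswap S e f : f \in S -> f \in E -> e \notin S :\ f -> good S ->
  gradual_transformation E good (e |: (S :\ f)) S
    (if f == e then [::] else [:: (Delete e, Insert f)]).
Proof.
move=> fS fE eS g; case: eqP => [<-|_] /=; first by rewrite setD1K.
by rewrite setU1K // setD1K //; split=> //; rewrite !inE ?eqxx ?fE.
Qed.

End Gradual.

(** * State of the algorithm and the union of two classes *)

Section Kruskal.
Variables (wle : rel nat) (R : realDomainType) (V : finType) (E : {set {set V}}).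
Variables (w : {set V} -> R) (nu : V -> nat) (en : {set V} -> nat).
Hypotheses (nu_inj : injective nu) (sE : simple_graph E).
Hypothesis en_inj : {in E &, injective en}.
Variables (Fs : bool -> {set {set V}}) (rk : bool -> V -> nat).
Variables (pe : bool -> V -> {set V}) (pv : bool -> V -> V).
Hypothesis rF : forall s, rooting (rk s) (pe s) (pv s) (Fs s).

Definition good S :=
  spanning_forest E S /\ (weight w S <= Num.max (weight w (Fs false)) (weight w (Fs true)))%R.

Definition trace (ph : seq (op {set V} * op {set V})) :=
  [seq map_op en o | o <- ops_of_phases ph].

Lemma trace_cat ph ph' : trace (ph ++ ph') = trace ph ++ trace ph'.
Proof. by rewrite /trace /ops_of_phases map_cat flatten_cat map_cat. Qed.

(** A stacked pair holds the edge gained and the edge lost by the forest that started as the target;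
    undoing goes from the last exchange to the first. *)
Definition unwind (st : seq ({set V} * {set V})) :=
  rev [seq (Delete x.1, Insert x.2) | x <- st].

Definition stack (m : memory) (st : seq ({set V} * {set V})) :=
  var m vc = size st /\ forall i, i < size st ->
    arr m aSe i = en (nth (set0, set0) st i).1 /\
    arr m aSf i = en (nth (set0, set0) st i).2.

(** [S false] is the actual edge set, reached by the phases [ph]. [S true] is only virtual: the
    exchanges leading to it from the target are kept in the stack [st], to be undone later. [nr]
    counts the unions. *)
Definition kstate (m : memory) (tr : seq (op nat)) (rt : V -> V) (nr : nat) :=
  exists dp rep S N st ph,
  [/\ union_find nu (arr m aUp) (arr m aSz) rt dp /\ #|[set v | rt v != v]| = nr,
      forall s, side E w nu en Fs rk pe s rt N (arr m aRk) (arr m aPar) (rep s) (S s),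
      gradual_transformation E good (Fs false) (S false) ph /\ tr = trace ph,
      gradual_transformation E good (S true) (Fs true) (unwind st)
    & stack m st /\ size st <= nr].

(** The exchange on the source side is performed at once, that on the target side is pushed on the
    stack; neither is recorded when an edge is exchanged for itself. *)
Definition union_roots : cmd :=
  (Put aUp (Var vb) (Add (Var va) (Const 1));;
   Put aSz (Var va) (Add (Add (Get aSz (Var va)) (Get aSz (Var vb))) (Const 1));;
   swap_edge false;;
   If (Eq (Var vf) (Var ve)) Skip
     (Perform (Delete (Var vf));; Perform (Insert (Var ve)));;
   swap_edge true;;
   If (Eq (Var vf) (Var ve)) Skip
     (Put aSe (Var vc) (Var ve);; Put aSf (Var vc) (Var vf);;
      Assign vc (Add (Var vc) (Const 1))))%C.

Definition union : cmd :=
  (If (Lt (Get aSz (Var va)) (Get aSz (Var vb)))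
     (Assign vi (Var va);; Assign va (Var vb);; Assign vb (Var vi)) Skip;;
   union_roots)%C.

Definition union_arrs := [:: aUp; aSz; aRk; aPar; aSe; aSf].
Definition union_vars := [:: vi; va; vb; vf; vc].

Lemma side_good s rt N rka para rep S :
  side E w nu en Fs rk pe s rt N rka para rep S -> good S.
Proof.
by case=> _ fS wS _; split=> //; rewrite le_max; case: s wS => ->; rewrite ?orbT.
Qed.

Lemma run_union_roots m tr rt nr x y :
  kstate m tr rt nr -> [set x; y] \in E -> rt x != rt y ->
  var m ve = en [set x; y] -> var m va = nu (rt x) -> var m vb = nu (rt y) ->
  (forall s f, f \in Fs s -> (w [set x; y] <= w f)%R \/
     (forall x y, f = [set x; y] -> rt x = rt y)) ->
  arr m aSz (nu (rt y)) <= arr m aSz (nu (rt x)) ->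
  run wle union_roots m (fun m' tr' t => exists rt',
    [/\ t <= 26, same_arrs union_arrs m m' /\ same_vars union_vars m m',
        kstate m' (tr ++ tr') rt' nr.+1,
        forall u v, rt u = rt v -> rt' u = rt' v
      & rt' x = rt' y]).
Proof.
move=> ks xyE rxy veE vaE vbE Fmin sz; case: ks => dp [rep [S [N [st [ph]]]]] [[uf nrE] sd [gr trE] gr' [[cE stE] sst]].
have root v := (uf_root uf v).2.
have uf' := union_findU nu_inj uf (root x) (root y) rxy sz.
have nr' := card_nonroot_union (root x) (root y) rxy.
apply: run_seq; apply: run_put; apply: run_seq; apply: run_put; rewrite /= vaE vbE addn1.
set m2 := set_arr _ _ _ _.
have fa2 : same_arrs union_arrs m m2 by rewrite /m2 /union_arrs; frame.
have fv2 : same_vars union_vars m m2 by rewrite /m2 /union_vars; frame.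
apply: run_seq.
have := run_swap_edge wle (m := m2) nu_inj sE rF (sd false) root xyE rxy vaE vbE (Fmin false).
move/run_conseq; apply.
move=> m3 tr3 t3 [f0 [rep0 [[-> t34] [fa3 fv3] [f0E [f0S nin0]] sd0 fr0]]].
have sd1 := side_frame nu_inj (sd true) (isT : true != false) fr0.
have veE3 : var m3 ve = en [set x; y] by rewrite (fv3 ve isT).
have vaE3 : var m3 va = nu (rt x) by rewrite (fv3 va isT).
have vbE3 : var m3 vb = nu (rt y) by rewrite (fv3 vb isT).
have inE1 s f : f \in S s -> f \in E.
  by case: (sd s) => _ [/subsetP h _ _] _ _; apply: h.
have eqE s f : f \in S s -> (en f <= en [set x; y]) && (en [set x; y] <= en f) = (f == [set x; y]).
  move=> fS; rewrite -eqn_leq; apply/eqP/eqP => [|-> //].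
  by apply: en_inj xyE; apply: inE1 fS.
set ph0 := if f0 == [set x; y] then [::] else [:: (Delete f0, Insert [set x; y])].
have gr0 := gradual_swap f0S xyE nin0 (side_good sd0).
rewrite -/ph0 in gr0.
apply: run_seq; set Q := (X in run _ _ _ X).
(* The rest of the program, shared by the two outcomes of the first test; [ph0] is empty or a single
   phase accordingly. *)
have main2 t5 : t5 <= 3 -> Q m3 (trace ph0) t5.
  move=> t53; rewrite /Q {Q}; apply: run_seq.
  have := run_swap_edge wle (m := m3) nu_inj sE rF sd1 root xyE rxy vaE3 vbE3 (Fmin true).
  move/run_conseq; apply.
  move=> m4 tr4 t4' [f1 [rep1 [[-> t44] [fa4 fv4] [f1E [f1S nin1]] sd1' fr1]]].
  have sd0' := side_frame nu_inj sd0 (isT : false != true) fr1.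
  have veE4 : var m4 ve = en [set x; y] by rewrite (fv4 ve isT).
  have gr1 := gradual_unswap f1S (inE1 _ _ f1S) nin1 (side_good (sd true)).
  have fa4' : same_arrs union_arrs m m4.
    by apply: (same_arrs_trans _ _ fa4) => //; apply: (same_arrs_trans _ _ fa3).
  have fv4' : same_vars union_vars m m4.
    by apply: (same_vars_trans _ _ fv4) => //; apply: (same_vars_trans _ _ fv3).
  have cE4 : var m4 vc = size st by rewrite (fv4 vc isT) (fv3 vc isT).
  have seE4 : arr m4 aSe = arr m aSe by rewrite (fa4 aSe isT) (fa3 aSe isT).
  have sfE4 : arr m4 aSf = arr m aSf by rewrite (fa4 aSf isT) (fa3 aSf isT).
  have fin m' : arr m' aUp = arr m4 aUp -> arr m' aSz = arr m4 aSz ->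
      arr m' aRk = arr m4 aRk -> arr m' aPar = arr m4 aPar ->
      stack m' (if f1 == [set x; y] then st else rcons st ([set x; y], f1)) ->
      kstate m' (tr ++ trace ph0) (union_rt rt (rt x) (rt y)) nr.+1.
    move=> e1 e2 e3 e4 stk; rewrite /kstate e1 e2 e3 e4.
    exists (union_dp rt dp (rt y)), (fun s => if s then rep1 else rep0).
    exists (fun s => [set x; y] |: (S s :\ if s then f1 else f0)), ([set x; y] |: N).
    exists (if f1 == [set x; y] then st else rcons st ([set x; y], f1)), (ph ++ ph0).
    split.
    - split; last by rewrite nr' nrE.
      by rewrite (fa4 aUp isT) (fa4 aSz isT) (fa3 aUp isT) (fa3 aSz isT).
    - by case.
    - by rewrite trace_cat trE; split=> //; apply: gradual_cat gr0.
    - rewrite /=; move: gr1; case: ifP => _ gr1; first exact: (gradual_cat gr1 gr').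
      by rewrite /unwind map_rcons rev_rcons; apply: (gradual_cat gr1 gr').
    - by split=> //; case: ifP => _; rewrite ?size_rcons //; apply: leqW.
  apply: run_if => /=; rewrite f1E veE4 (eqE true) // => f1e.
    step; rewrite cats0; exists (union_rt rt (rt x) (rt y)); split=> //.
    - lia.
    - by apply: fin => //; rewrite f1e; split=> //; rewrite seE4 sfE4.
    - by move=> u v /(union_rtP rt (rt x) (rt y) u v).1.
    - by rewrite /union_rt !eqxx (negbTE rxy).
  steps; rewrite /= cats0 f1E veE4 cE4; exists (union_rt rt (rt x) (rt y)); split=> //.
  - lia.
  - by split; rewrite /union_arrs /union_vars in fa4' fv4' *; frame.
  - apply: fin => //; rewrite (negbTE f1e); split; rewrite /= size_rcons ?addn1 //.
    move=> i; rewrite ltnS nth_rcons seE4 sfE4 leq_eqVlt => /orP[/eqP->|lt].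
      by rewrite eqxx ltnn.
    by rewrite lt (ltn_eqF lt); apply: stE.
  - by move=> u v /(union_rtP rt (rt x) (rt y) u v).1.
  - by rewrite /union_rt !eqxx (negbTE rxy).
apply: run_if => /=; rewrite f0E veE3 (eqE false) // => f0e.
  by step; have := main2 2 isT; rewrite /ph0 f0e.
by steps; have := main2 3 isT; rewrite /ph0 (negbTE f0e) /= f0E veE3.
Qed.

Lemma run_union m tr rt nr x y :
  kstate m tr rt nr -> [set x; y] \in E -> rt x != rt y ->
  var m ve = en [set x; y] -> var m va = nu (rt x) -> var m vb = nu (rt y) ->
  (forall s f, f \in Fs s -> (w [set x; y] <= w f)%R \/
     (forall x y, f = [set x; y] -> rt x = rt y)) ->
  run wle union m (fun m' tr' t => exists rt',
    [/\ t <= 30, same_arrs union_arrs m m' /\ same_vars union_vars m m',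
        kstate m' (tr ++ tr') rt' nr.+1,
        forall u v, rt u = rt v -> rt' u = rt' v
      & rt' x = rt' y]).
Proof.
move=> ks xyE rxy veE vaE vbE Fmin.
apply: run_seq; apply: run_if => /=; rewrite vaE vbE addn1.
  move=> lt; steps; rewrite /= vaE vbE; set m1 := set_var _ _ _.
  have fv : same_vars union_vars m m1 by rewrite /m1 /union_vars; frame.
  have yxE : [set x; y] = [set y; x] by rewrite setUC.
  rewrite yxE in xyE veE Fmin; rewrite eq_sym in rxy.
  have ks1 : kstate m1 tr rt nr by [].
  have := run_union_roots ks1 xyE rxy veE erefl erefl Fmin (ltnW lt).
  move/run_conseq; apply=> m' tr' t [rt' [t26 [fa' fv'] ks' rtP rxy']].
  exists rt'; split=> //.
  by split=> //; apply: same_vars_trans fv'.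
rewrite -leqNgt => le; step.
have := run_union_roots ks xyE rxy veE vaE vbE Fmin le.
move/run_conseq; apply=> m' tr' t [rt' [t26 fr ks' rtP rxy']].
by exists rt'; split=> //; apply: leq_trans (leq_add (leqnn _) t26) _.
Qed.

End Kruskal.

(** * The main loop and the reversal of the stacked exchanges *)

Section KruskalLoop.
Variables (wle : rel nat) (R : realDomainType) (V : finType) (E : {set {set V}}).
Variables (w : {set V} -> R) (nu : V -> nat) (en : {set V} -> nat).
Hypotheses (nu_inj : injective nu) (sE : simple_graph E).
Hypothesis en_inj : {in E &, injective en}.
Variables (Fs : bool -> {set {set V}}) (rk : bool -> V -> nat).
Variables (pe : bool -> V -> {set V}) (pv : bool -> V -> V).
Hypothesis rF : forall s, rooting (rk s) (pe s) (pv s) (Fs s).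

Local Notation invariant := (kstate E w nu en Fs rk pe).

Lemma kstate_eq m m' tr rt nr :
  arr m' aUp = arr m aUp -> arr m' aSz = arr m aSz -> arr m' aRk = arr m aRk ->
  arr m' aPar = arr m aPar -> arr m' aSe = arr m aSe -> arr m' aSf = arr m aSf ->
  var m' vc = var m vc -> invariant m tr rt nr -> invariant m' tr rt nr.
Proof. by rewrite /kstate /stack => -> -> -> -> -> -> ->. Qed.

Definition unwind_stack : cmd :=
  (While (Leq (Const 1) (Var vc))
    (Assign vc (Defs.Sub (Var vc) (Const 1));;
     Perform (Delete (Get aSe (Var vc)));;
     Perform (Insert (Get aSf (Var vc)))))%C.

Lemma run_unwind_stack m st : stack en m st ->
  run wle unwind_stack m (fun _ tr t => tr = trace en (unwind st) /\ t <= 4 * size st + 1).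
Proof.
move=> stk.
(* [st1] is still to be undone and [st2] already has been; popping at the end of [st1] yields the
   reversed order of [unwind]. *)
pose I m' tr p := exists st1 st2, [/\ st = st1 ++ st2, stack en m' st1,
  tr = trace en (unwind st2) & p = 4 * size st1].
apply: run_conseq.
  apply: (run_while (I := I) (tr := [::]) (p := 4 * size st)); last first.
    by exists st, [::]; rewrite cats0.
  move=> m1 tr p [st1 [st2 [stE [cE sk] -> ->]]] /=; rewrite cE.
  case/lastP: st1 => [//|st1 x] in stE cE sk * => _.
  rewrite size_rcons in cE sk *.
  have [sx fx] := sk (size st1) (ltnSn _); rewrite nth_rcons ltnn eqxx in sx fx.
  steps; rewrite /= cE subn1 /=; exists (4 * size st1); split; last by lia.
  exists st1, (x :: st2); split=> //.
  - by rewrite stE cat_rcons.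
  - split=> //= i ilt; have := sk i (ltnW ilt); rewrite nth_rcons ilt => -[-> ->] //.
  by rewrite /unwind /= rev_cons -cats1 trace_cat sx fx.
move=> m' tr t [p' [[st1 [st2 [stE [cE _] /= -> ->]]]]]; rewrite cE -leqNgt leqn0.
move=> /nilP st0 tp; have <- : st = st2 by rewrite stE st0.
by split=> //; lia.
Qed.

Variables (n : nat) (el : nat -> nat) (ed : nat -> {set V}) (ex ey : nat -> V).
Hypothesis elE : forall p, n <= p < n + n -> el p = en (ed p).
Hypothesis edE : forall p, n <= p < n + n -> ed p \in E /\ ed p = [set ex p; ey p].
Hypothesis FsE : forall s f, f \in Fs s -> exists2 p, n <= p < n + n & ed p = f.
Hypothesis wleE : {in E &, forall e f, wle (en e) (en f) = (w e <= w f)%R}.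

(** An edge common to both forests occupies two slots; when the second is extracted, its ends are
    already in one class and it is skipped. *)
Definition kruskal : cmd :=
  (Assign vj (Const 0);; Assign vc (Const 0);;
   While (Lt (Var vj) (Var vn))
    (Assign vi (Get aT (Const 1));;
     Assign ve (Get aEL (Var vi));;
     Put aT (Var vi) (Const 0);;
     sift;;
     Assign vj (Add (Var vj) (Const 1));;
     Assign va (Get aE1 (Var ve));;
     Assign vb (Get aE2 (Var ve));;
     find_root va;;
     find_root vb;;
     If (Eq (Var va) (Var vb)) Skip union))%C.

Definition kruskal_arrs := aT :: union_arrs.
Definition kruskal_vars := [:: vj; ve] ++ union_vars.

Let B := 7 * trunc_log 2 (n + n) + 4 * trunc_log 2 n + 50.

Lemma run_kruskal m : var m vn = n -> arr m aEL = el ->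
  (forall p, n <= p < n + n ->
     arr m aE1 (el p) = nu (ex p) /\ arr m aE2 (el p) = nu (ey p)) ->
  (forall i, 1 < i < n + n -> arr m aHalf i = i./2) ->
  (forall i, 0 < i < n -> heap_at wle el (arr m aT) i) ->
  (forall p, n <= p < n + n -> arr m aT p = p) ->
  invariant (set_var m vc 0) [::] id 0 ->
  run wle kruskal m (fun m' tr t => exists rt nr,
    [/\ invariant m' tr rt nr, nr <= n, t <= n * B + 3
      & forall p, n <= p < n + n -> rt (ex p) = rt (ey p)]).
Proof.
move=> nE EL ends halfE hp0 lf0 ks0.
(* [A] marks the slots still in the tree; the ends of every other slot lie in one class. *)
pose I m' (tr : seq (op nat)) p := exists rt nr (A : pred nat),
  [/\ invariant m' tr rt nr, nr <= var m' vj <= n /\ p = (n - var m' vj) * B,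
      same_arrs kruskal_arrs m m' /\ same_vars kruskal_vars m m',
      [/\ forall i, 0 < i < n -> heap_at wle el (arr m' aT) i,
          forall p, n <= p < n + n -> arr m' aT p = if A p then p else 0
        & count A (iota n n) = n - var m' vj]
    & forall p, n <= p < n + n -> ~~ A p -> rt (ex p) = rt (ey p)].
do 2!(apply: run_seq; apply: run_assign); apply: run_conseq.
  apply: (run_while (I := I) (tr := [::]) (p := n * B)); last first.
    exists id, 0, predT; split=> //=.
    - by rewrite subn0.
    - by split; rewrite /kruskal_arrs /kruskal_vars; frame.
    - by split=> //; rewrite count_predT size_iota subn0.
  move=> m1 tr p [rt [nr [A [ks [nrj ->] [fa fv] [hp lf cA] pA]]]] /=.
  rewrite (fv vn isT) nE => jn; set j := var m1 vj in nrj jn cA *.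
  have [p0 p0n Ap0] : exists2 p, n <= p < n + n & A p.
    have : has A (iota n n) by rewrite has_count cA; lia.
    by case/hasP=> q; rewrite mem_iota; exists q.
  have wleT : {in [pred p | n <= p < n + n] & &, transitive (fun p q => wle (el p) (el q))}.
    move=> q1 q2 q3 h1 h2 h3; rewrite !elE // !wleE; try exact: (edE _).1.
    exact: le_trans.
  have wleTot : {in [pred p | n <= p < n + n] &, total (fun p q => wle (el p) (el q))}.
    move=> q1 q2 h1 h2; rewrite !elE // !wleE; try exact: (edE _).1.
    exact: le_total.
  have [] := heap_rootP hp lf wleT wleTot p0n Ap0.
  set q := arr m1 aT 1 => qn Aq qmin.
  have [qE qxy] := edE qn.
  have [q1E q2E] := ends q qn.
  do 6!step; rewrite /= -/q (fa aEL isT) EL.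
  step; set m2 := set_arr _ _ _ _.
  have fa2 : same_arrs kruskal_arrs m m2 by rewrite /m2 /kruskal_arrs; frame.
  have fv2 : same_vars kruskal_vars m m2 by rewrite /m2 /kruskal_vars; frame.
  have := @run_sift wle el n m2.
  rewrite /= (fa aEL isT) (fa aHalf isT) => /(_ EL) []//; first by lia.
    move=> i i0 iq; rewrite /heap_at; do !(case: eqP; first by lia).
    by move=> _ _ _; apply: hp.
  move=> m3 [tr3 [t3 [ex3 [tr3E t3le [fa3 fv3] hp3 lf3]]]].
  exists m3, tr3, t3; split=> //; rewrite tr3E.
  have fa3' : same_arrs kruskal_arrs m m3 by apply: same_arrs_trans fa3.
  have fv3' : same_vars kruskal_vars m m3 by apply: same_vars_trans fv3.
  have jE : var m3 vj = j by rewrite (fv3 vj isT).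
  have eE : var m3 ve = el q by rewrite (fv3 ve isT).
  apply: run_seq; apply: run_assign; apply: run_seq; apply: run_assign.
  apply: run_seq; apply: run_assign.
  rewrite /= jE eE (fa3' aE1 isT) (fa3' aE2 isT) q1E q2E addn1.
  set m4 := set_var _ _ _.
  have fv4 : same_vars kruskal_vars m m4 by rewrite /m4 /kruskal_vars; frame.
  have ks4 : invariant m4 tr rt nr.
    by apply: kstate_eq ks; rewrite /= ?(fa3 aUp isT) ?(fa3 aSz isT) ?(fa3 aRk isT)
      ?(fa3 aPar isT) ?(fa3 aSe isT) ?(fa3 aSf isT) ?(fv3 vc isT).
  have [dp [_ [_ [_ [_ [_ [[uf nrE] _ _ _ _]]]]]]] := ks4.
  (* At most [j] unions have taken place, and [j] is less than [n]. *)
  have depth v : dp v <= trunc_log 2 n.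
    apply: leq_trans (uf_depth uf v) _; apply: leq_trunc_log; rewrite nrE; lia.
  step; have := @run_find wle V nu _ _ _ _ uf m4 va (ex q) erefl erefl.
  move/run_conseq; apply=> m5 _ t5 [-> t5le fa5 fv5 vaE5].
  have upE5 : arr m5 aUp = arr m4 aUp by rewrite (fa5 aUp isT).
  have vbE5 : var m5 vb = nu (ey q) by rewrite (fv5 vb isT).
  step; have := @run_find wle V nu _ _ _ _ uf m5 vb (ey q) upE5 vbE5.
  move/run_conseq; apply=> m6 _ t6 [-> t6le fa6 fv6 vbE6].
  have vaE6 : var m6 va = nu (rt (ex q)) by rewrite (fv6 va isT).
  have fa6' : same_arrs kruskal_arrs m m6.
    apply: (same_arrs_trans _ _ fa6) => //; apply: (same_arrs_trans _ _ fa5) => //.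
  have fv6' : same_vars kruskal_vars m m6.
    apply: (same_vars_trans _ _ fv6) => //; apply: (same_vars_trans _ _ fv5) => //.
  have tE6 : arr m6 aT = arr m3 aT by rewrite (fa6 aT isT) (fa5 aT isT).
  have jE6 : var m6 vj = j.+1 by rewrite (fv6 vj isT) (fv5 vj isT).
  have ks6 : invariant m6 tr rt nr.
    by apply: kstate_eq ks4; rewrite ?(fa6 aUp isT) ?(fa6 aSz isT) ?(fa6 aRk isT)
      ?(fa6 aPar isT) ?(fa6 aSe isT) ?(fa6 aSf isT) ?(fv6 vc isT)
      ?(fa5 aUp isT) ?(fa5 aSz isT) ?(fa5 aRk isT)
      ?(fa5 aPar isT) ?(fa5 aSe isT) ?(fa5 aSf isT) ?(fv5 vc isT).
  pose A' := [pred i | A i && (i != q)].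
  have cA' : count A' (iota n n) = n - j.+1.
    have := count_predC (pred1 q) (filter A (iota n n)).
    rewrite !count_filter size_filter cA.
    rewrite (eq_count (a2 := pred1 q)); last first.
      by move=> i /=; case: eqP => // ->.
    rewrite count_uniq_mem ?iota_uniq // mem_iota qn.
    rewrite (eq_count (a2 := A')); last by move=> i /=; rewrite andbC.
    lia.
  have lf' i : n <= i < n + n -> arr m3 aT i = if A' i then i else 0.
    move=> iN; rewrite lf3; last by lia.
    rewrite /=; case: eqP => [->|_]; first by rewrite andbF.
    by rewrite andbT lf.
  have time : trunc_log 2 q <= trunc_log 2 (n + n) by apply: leq_trunc_log; lia.
  have tB : (n - j) * B = B + (n - j.+1) * B.
    by rewrite -mulSn; congr (_ * _); lia.
  have d1 := depth (ex q); have d2 := depth (ey q).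
  have t56 : t5 + t6 <= 4 * trunc_log 2 n + 2 by lia.
  apply: run_if => /=; rewrite vaE6 vbE6 -eqn_leq (inj_eq nu_inj) => rxy.
    step; exists ((n - j.+1) * B); rewrite cats0; split; last by rewrite tB /B; lia.
    exists rt, nr, A'; rewrite jE6 tE6; split=> //.
    - by split=> //; lia.
    - move=> i iN; rewrite /= negb_and negbK => /orP[/(pA i iN)//|/eqP->].
      exact/eqP.
  (* A slot still in the tree is no lighter than the extracted minimum; the ends of a slot extracted
     before lie in one class. *)
  have Fmin s f : f \in Fs s -> (w [set ex q; ey q] <= w f)%R \/
      (forall x y, f = [set x; y] -> rt x = rt y).
    case/FsE=> i iN <-; have [iE ixy] := edE iN.
    case: (boolP (A i)) => [Ai|NAi].
      by left; rewrite -qxy -wleE // -!elE //; apply: qmin.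
    right=> x y; rewrite ixy => /esym/set2_eq[] [-> ->]; [exact: pA|].
    by apply/esym/pA.
  have veE6 : var m6 ve = en [set ex q; ey q].
    by rewrite (fv6 ve isT) (fv5 ve isT) /= eE elE // qxy.
  have xyE : [set ex q; ey q] \in E by rewrite -qxy.
  have := run_union wle nu_inj sE en_inj rF ks6 xyE rxy veE6 vaE6 vbE6 Fmin.
  move/run_conseq; apply=> m7 tr7 t7 [rt' [t7le [fa7 fv7] ks7 rt'P rt'q]].
  exists ((n - j.+1) * B); split; last by rewrite tB /B; lia.
  exists rt', nr.+1, A'; rewrite (fv7 vj isT) (fa7 aT isT) jE6 tE6; split=> //.
  - by split=> //; lia.
  - split.
      by apply: (same_arrs_trans _ _ fa7).
    by apply: (same_vars_trans _ _ fv7).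
  - move=> i iN; rewrite /= negb_and negbK => /orP[/(pA i iN)/rt'P//|/eqP->//].
move=> m' tr t [p' [[rt [nr [A [ks [nrj ->] [fa fv] [_ _ cA] pA]]]]]] /=.
rewrite (fv vn isT) nE => jn tp; exists rt, nr; split=> //; try lia.
move=> p pn; apply: pA => //; apply/negP=> Ap.
have : has A (iota n n) by apply/hasP; exists p; rewrite ?mem_iota.
rewrite has_count cA; lia.
Qed.

End KruskalLoop.

(** * The transformation *)

Section Transform.
Variables (R : realDomainType) (V : finType) (E : {set {set V}}).
Variables (w : {set V} -> R) (F F' : {set {set V}}).
Hypotheses (sE : simple_graph E).
Hypotheses (sF : spanning_forest E F) (sF' : spanning_forest E F').
Variables (nu : V -> nat) (en : {set V} -> nat) (wle : rel nat) (m : memory).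
Hypothesis inp : input E w F F' nu en wle m.
Variable v0 : V.

Let n := #|F| + #|F'|.
Let Fs (s : bool) := if s then F' else F.
Let sd j := n + #|F| <= j.
Let el j := if j < n + #|F| then arr m aF (j - n) else arr m aF' (j - n - #|F|).
Let ed j := odflt set0 [pick e in Fs (sd j) | en e == el j].

Let nuI := vertex_num_inj inp.
Let enI := edge_num_inj inp.

Let sFs s : spanning_forest E (Fs s). Proof. by case: s. Qed.

Let FsE s f : f \in Fs s -> f \in E.
Proof. by case: (sFs s) => /subsetP h _ _; apply: h. Qed.

Lemma lists_mem (G : {set {set V}}) a i : lists en G a -> i < #|G| ->
  exists2 e, e \in G & en e = a i.
Proof.
move=> /perm_mem h iG; have : a i \in mkseq a #|G| by apply: map_f; rewrite mem_iota.
by rewrite h => /mapP[e]; rewrite mem_enum => eG ->; exists e.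
Qed.

Lemma lists_inv (G : {set {set V}}) a e : lists en G a -> e \in G ->
  exists2 i, i < #|G| & a i = en e.
Proof.
move=> /perm_mem h eG; have : en e \in [seq en e | e <- enum G].
  by apply: map_f; rewrite mem_enum.
by rewrite -h => /mapP[i]; rewrite mem_iota => iG ->; exists i.
Qed.

Lemma lists_inj (G : {set {set V}}) a i j : {in G &, injective en} -> lists en G a ->
  i < #|G| -> j < #|G| -> a i = a j -> i = j.
Proof.
move=> eI /perm_uniq h iG jG; have : uniq (mkseq a #|G|).
  rewrite h map_inj_in_uniq ?enum_uniq // => e f.
  by rewrite !mem_enum; apply: eI.
move=> un aij; apply/eqP; rewrite -(nth_uniq 0 _ _ un) ?size_mkseq //.
by rewrite !nth_mkseq // aij.
Qed.

Let lF := input_F inp.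
Let lF' := input_F' inp.

Let edP j : n <= j < n + n -> ed j \in Fs (sd j) /\ en (ed j) = el j.
Proof.
move=> jn; have [e eF ee] : exists2 e, e \in Fs (sd j) & en e = el j.
  rewrite /el /sd; case: leqP => jk.
    by apply: (lists_mem lF'); rewrite /n in jn jk *; lia.
  by apply: (lists_mem lF); rewrite /n in jn jk *; lia.
rewrite /ed; case: pickP => [f /andP[fF /eqP fe] //|/(_ e)].
by rewrite /= eF ee eqxx.
Qed.

Let edE j : n <= j < n + n -> ed j \in E.
Proof. by move=> /edP[h _]; apply: FsE h. Qed.

Let ed_surj s f : f \in Fs s -> exists j, [/\ n <= j < n + n, sd j = s & ed j = f].
Proof.
move=> fF; have [j [jn js je]] : exists j, [/\ n <= j < n + n, sd j = s & el j = en f].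
  case: s fF => fF.
    have [i iF ie] := lists_inv lF' fF.
    exists (n + #|F| + i); split; [by rewrite /n; lia | by rewrite /sd leq_addr |].
    by rewrite /el ltnNge leq_addr /= -addnA !addKn.
  have [i iF ie] := lists_inv lF fF.
  exists (n + i); split; [by rewrite /n; lia | by rewrite /sd leq_add2l leqNgt iF |].
  by rewrite /el ltn_add2l iF addKn.
exists j; split=> //; have [h1 h2] := edP jn.
by apply: enI; [exact: edE | exact: FsE fF | rewrite h2].
Qed.

Let ed_inj i j : n <= i < n + n -> n <= j < n + n -> sd i = sd j -> ed i = ed j -> i = j.
Proof.
move=> iN jn ss ee; have [_ ei] := edP iN; have [_ ej] := edP jn.
have : el i = el j by rewrite -ei -ej ee.
have sub (G : {set {set V}}) : G \subset E -> {in G &, injective en}.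
  by move=> /subsetP h e f /h eE /h fE; apply: enI.
have subF : {in F &, injective en} by apply: sub; case: sF.
have subF' : {in F' &, injective en} by apply: sub; case: sF'.
rewrite /sd in ss; rewrite /el !ltnNge ss; move: ss.
case: (leqP (n + #|F|) j) => jk /= ik h.
  have ik' : n + #|F| <= i by rewrite ik.
  have := lists_inj subF' lF' _ _ h; rewrite /n in iN jn jk ik' * => hi.
  by move: #|F| #|F'| iN jn jk ik' hi => a b; clear; lia.
have ik' : i < n + #|F| by rewrite ltnNge ik.
have := lists_inj subF lF _ _ h; rewrite /n in iN jn jk ik' * => hi.
by move: #|F| #|F'| iN jn jk ik' hi => a b; clear; lia.
Qed.

Let endsP : exists ends : {set V} -> V * V, forall e, e \in E ->
  [/\ e = [set (ends e).1; (ends e).2], arr m aE1 (en e) = nu (ends e).1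
    & arr m aE2 (en e) = nu (ends e).2].
Proof.
apply: (fin_all_exists (P := fun e xy => e \in E ->
  [/\ e = [set xy.1; xy.2], arr m aE1 (en e) = nu xy.1 & arr m aE2 (en e) = nu xy.2])).
(* For sets that are not edges any pair will do, and [v0] supplies one. *)
move=> e; case: (boolP (e \in E)) => [eE|_]; last by exists (v0, v0).
by have [x [y h]] := input_ends inp eE; exists (x, y).
Qed.

Definition transform : cmd :=
  (load;; peel;; halves;; build_heap;; kruskal;; unwind_stack)%C.

Section Ends.
Variable ends : {set V} -> V * V.
Hypothesis endsE : forall e, e \in E ->
  [/\ e = [set (ends e).1; (ends e).2], arr m aE1 (en e) = nu (ends e).1
    & arr m aE2 (en e) = nu (ends e).2].

Let ex j := (ends (ed j)).1.
Let ey j := (ends (ed j)).2.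
Let u j := dbl nu (sd j) (ex j).
Let w' j := dbl nu (sd j) (ey j).

Let edxy j : n <= j < n + n -> ed j = [set ex j; ey j].
Proof. by move=> jn; have [] := endsE (edE jn). Qed.

Let exNey j : n <= j < n + n -> ex j != ey j.
Proof. by move=> jn; apply: (adj_neq sE); rewrite /adj -edxy ?edE. Qed.

Let uw j : n <= j < n + n -> u j != w' j.
Proof. by move=> jn; apply: contra (exNey jn) => /eqP/(dbl_inj nuI)[_ ->]. Qed.

Let incE s v j : n <= j < n + n -> inc u w' (dbl nu s v) j = (sd j == s) && (v \in ed j).
Proof.
move=> jn; rewrite /= (edxy jn) !inE.
have dE x : (dbl nu (sd j) x == dbl nu s v) = (sd j == s) && (v == x).
  by apply/eqP/andP => [/(dbl_inj nuI)[-> ->]|[/eqP-> /eqP->]].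
by rewrite !dE; case: (sd j == s).
Qed.

(** The slots of [Q] on the side of its first slot carry a nonempty subset of one of the forests,
    which has a leaf by [acyclic_leaf]. On the doubled vertices, slots of the other side do not
    contribute to its degree. *)
Let leaf Q : uniq Q -> {subset Q <= iota n n} -> Q != [::] ->
  exists x, count (inc u w' x) Q = 1.
Proof.
move=> uQ sQ; case E0: Q => [//|j0 Q0] _; have j0Q : j0 \in Q by rewrite E0 mem_head.
rewrite -E0; have Qn j : j \in Q -> n <= j < n + n by move/sQ; rewrite mem_iota.
pose s := sd j0; pose T := [set e in [seq ed j | j <- Q & sd j == s]].
have TF : T \subset Fs s.
  apply/subsetP=> e; rewrite inE => /mapP[j]; rewrite mem_filter => /andP[/eqP <- jQ] ->.
  by have [] := edP (Qn _ jQ).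
have [v vT] : exists v, #|[set f in T | v \in f]| = 1.
  apply: (@acyclic_leaf _ T (ed j0)).
  - by move=> e /(subsetP TF)/FsE/sE.
  - by apply: (acyclic_sub TF); case: (sFs s).
  - by rewrite inE; apply/mapP; exists j0; rewrite // mem_filter eqxx.
exists (dbl nu s v); rewrite -vT -size_filter.
rewrite -(size_map ed); apply/esym.
have un : uniq [seq ed j | j <- Q & inc u w' (dbl nu s v) j].
  rewrite map_inj_in_uniq ?filter_uniq // => i j; rewrite !mem_filter.
  move=> /andP[ii iQ] /andP[ij jQ]; apply: ed_inj; try exact: Qn.
  by move: ii ij; rewrite !incE ?Qn // => /andP[/eqP-> _] /andP[/eqP-> _].
rewrite -(card_uniqP un); apply: eq_card => f; rewrite !inE.
apply/andP/mapP => [[/mapP[j]]|[j]]; rewrite mem_filter.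
  by move=> /andP[sj jQ] -> vj; exists j => //; rewrite mem_filter incE ?Qn // sj vj.
rewrite andbC => /andP[jQ]; rewrite incE ?Qn // => /andP[sj vj] ->; split=> //.
by apply/mapP; exists j; rewrite // mem_filter sj.
Qed.

(** With no slot left, each slot has been peeled at one of its ends, so every edge of [Fs s] is a
    parent edge; the doubling of the vertices keeps the two forests apart. *)
Lemma peeled_rooting rank par (rk := fun s v => rank (dbl nu s v)) :
  peeled n u w' el rank par [::] ->
  exists (pe : bool -> V -> {set V}) (pv : bool -> V -> V), forall s,
    rooting (rk s) (pe s) (pv s) (Fs s) /\
    forall v, 0 < rk s v -> par (dbl nu s v) = en (pe s v).
Proof.
move=> [_ _ jP xP].
have gP s v : exists g : {set V} * V, 0 < rk s v ->
    [/\ g.1 \in Fs s, g.1 = [set v; g.2], rk s g.2 < rk s v & par (dbl nu s v) = en g.1].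
  case: (posnP (rk s v)) => [|rv]; first by exists (set0, v).
  have [j [y [jn jy pj lt]]] := xP _ rv; have [ejF eje] := edP jn.
  case: jy => -[uE wE].
    have [sj xv] := dbl_inj nuI uE; exists (ed j, ey j) => _ /=; rewrite sj in ejF.
    split; [by [] | by rewrite -xv -edxy | | by rewrite pj eje].
    by move: lt; rewrite -wE /w' sj.
  have [sj yv] := dbl_inj nuI wE; exists (ed j, ex j) => _ /=; rewrite sj in ejF.
  split; [by [] | by rewrite -yv setUC -edxy | | by rewrite pj eje].
  by move: lt; rewrite -uE /u sj.
have [g gE] := fin_all_exists (fun s => fin_all_exists (gP s)).
exists (fun s v => (g s v).1), (fun s v => (g s v).2) => s; split; last first.
  by move=> v /gE[].
split=> [v /gE[]//|v /gE[]//|]; apply/setP=> f; apply/idP/imsetP => [fF|[v]]; last first.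
  by rewrite inE => /gE[? _ _ _] ->.
have [j [jn sj ejf]] := ed_surj fF; have [x [xj rx px]] := jP j jn isT.
have [v xv] : exists v, x = dbl nu s v.
  by case/orP: xj => /eqP <-; rewrite /u /w' sj; [exists (ex j) | exists (ey j)].
rewrite xv in rx px; exists v; rewrite ?inE //.
have [gF _ _ pg] := gE _ _ rx; have [_ ee] := edP jn.
by apply: enI; rewrite ?(FsE gF) ?(FsE fF) // -pg px -ee ejf.
Qed.

Lemma run_transform : 0 < n ->
  run wle transform m (fun m' tr t => exists ph,
    [/\ gradual_transformation E (good E w Fs) F F' ph, tr = trace en ph
      & t <= n * (14 * trunc_log 2 (n + n) + 4 * trunc_log 2 n + 95) + 20]).
Proof.
move=> n0.
have kE : var m vk = #|F| := input_sizeF inp.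
have k'E : var m vk' = #|F'| := input_sizeF' inp.
have a0 a i : a \notin [:: 0; 1; 2; 3] -> arr m a i = 0 := input_arr0 inp i.
have slotE j : n <= j < n + n ->
    [/\ el j = (if j < n + #|F| then arr m aF (j - n) else arr m aF' (j - n - #|F|)),
        u j = arr m aE1 (el j) + arr m aE1 (el j) + (n + #|F| <= j)
      & w' j = arr m aE2 (el j) + arr m aE2 (el j) + (n + #|F| <= j)].
  move=> jn; have [_ ee] := edP jn; have [_ e1 e2] := endsE (edE jn).
  by rewrite ee in e1 e2; split; rewrite ?e1 ?e2.
rewrite /transform; step; have := run_load wle uw (k := #|F|) _ (esym kE) slotE (fun x => a0 aDeg x isT) (fun x => a0 aSum x isT).
rewrite kE k'E => /(_ erefl)/run_conseq; apply=> m1 _ t1 [[-> t1le] [fa1 fv1] nE1 sl1 dg1].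
have rk1 x : arr m1 aRk x = 0 by rewrite (fa1 aRk isT) a0.
step; have := run_peel wle uw leaf nE1 sl1 rk1 dg1.
move/run_conseq; apply=> m2 _ t2 [[-> t2le] [fa2 fv2] pl].
have nE2 : var m2 vn = n by rewrite (fv2 vn isT).
step; have := run_halves wle nE2.
move/run_conseq; apply=> m3 _ t3 [-> t3le [fa3 fv3] hf].
have nE3 : var m3 vn = n by rewrite (fv3 vn isT).
have t0 i : arr m3 aT i = 0 by rewrite (fa3 aT isT) (fa2 aT isT) (fa1 aT isT) a0.
step; have := run_build_heap wle nE3 erefl hf t0.
move/run_conseq; apply=> m4 _ t4 [-> t4le [fa4 fv4] hp lf].
have [pe [pv rooted]] := peeled_rooting pl.
set rk := fun s v => arr m2 aRk (dbl nu s v) in rooted.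
have rF s := (rooted s).1.
have E4 : arr m4 aEL = arr m1 aEL.
  by rewrite (fa4 aEL isT) (fa3 aEL isT) (fa2 aEL isT).
have el4 p : n <= p < n + n -> arr m1 aEL p = en (ed p).
  by move=> pn; have [-> _ _] := sl1 p pn; have [] := edP pn.
have nE4 : var m4 vn = n by rewrite (fv4 vn isT).
have FsE2 s f : f \in Fs s -> exists2 p, n <= p < n + n & ed p = f.
  by move/ed_surj => [p [pn _ pf]]; exists p.
have ed2 p : n <= p < n + n -> ed p \in E /\ ed p = [set ex p; ey p].
  by move=> pn; split; [apply: edE | apply: edxy].
have ends4 p : n <= p < n + n ->
    arr m4 aE1 (arr m1 aEL p) = nu (ex p) /\ arr m4 aE2 (arr m1 aEL p) = nu (ey p).
  move=> pn; rewrite el4 //; have [_ <- <-] := endsE (edE pn).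
  by rewrite (fa4 aE1 isT) (fa3 aE1 isT) (fa2 aE1 isT) (fa1 aE1 isT)
    (fa4 aE2 isT) (fa3 aE2 isT) (fa2 aE2 isT) (fa1 aE2 isT).
have hf4 i : 1 < i < n + n -> arr m4 aHalf i = i./2.
  by rewrite (fa4 aHalf isT); apply: hf.
have ks0 : kstate E w nu en Fs rk pe (set_var m4 vc 0) [::] id 0.
  exists (fun=> 0), (fun=> id), Fs, set0, [::], [::]; split=> //.
  - split.
      apply: union_find_init => i /=.
        by rewrite (fa4 aUp isT) (fa3 aUp isT) (fa2 aUp isT) (fa1 aUp isT) a0.
      by rewrite (fa4 aSz isT) (fa3 aSz isT) (fa2 aSz isT) (fa1 aSz isT) a0.
    by apply: eq_card0 => v; rewrite !inE eqxx.
  - move=> s; split=> //; first exact: (hybrid_init (rF s)).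
    move=> v _ /=; rewrite (fa4 aRk isT) (fa3 aRk isT) (fa4 aPar isT) (fa3 aPar isT).
    by split=> //; apply: (rooted s).2.
step; have := run_kruskal nuI sE enI rF el4 ed2 FsE2 (input_wle inp) nE4 E4 ends4 hf4.
rewrite -E4 (fa4 aEL isT) => /(_ hp lf ks0)/run_conseq; apply=> m5 tr5 t5 [rt [nr [ks nrn t5le closed]]].
have [dp [rep [S [N [st [ph [_ sd5 [gr ->] gr' [stk sst]]]]]]]] := ks.
(* All edges of both forests now lie inside classes, so both have been turned into the set [N] of
   accepted edges; there the performed phases and the unwinding ones meet. *)
have SN s : S s = N.
  have [hyb _ _ _] := sd5 s; apply: (hybrid_root_final (rF s) hyb) => v rv.
  have : pe s v \in Fs s by rewrite (rooting_set (rF s)); apply: imset_f; rewrite inE.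
  move/ed_surj => [p [pn _]]; rewrite edxy // (rooting_edge (rF s) rv).
  by case/set2_eq=> [] [<- <-]; rewrite closed.
have := run_unwind_stack wle stk; move/run_conseq; apply=> m6 tr6 t6 [-> t6le].
exists (ph ++ unwind st); split.
- by apply: gradual_cat gr _; rewrite SN -(SN true).
- by rewrite trace_cat.
rewrite !mulnDr in t4le t5le *; lia.
Qed.

End Ends.

Lemma transform_correct : 1 < n ->
  run wle transform m (fun m' tr t => exists ph,
    [/\ gradual_transformation E (good E w Fs) F F' ph, tr = trace en ph
      & t <= 131 * (n * trunc_log 2 n).+1]).
Proof.
move=> n1; have [ends endsE] := endsP.
have := run_transform endsE (ltnW n1).
move/run_conseq; apply=> m' tr t [ph [gr trE tle]]; exists ph; split=> //.
apply: leq_trans tle _.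
have -> : trunc_log 2 (n + n) = (trunc_log 2 n).+1.
  by rewrite trunc_log2S ?addnn ?doubleK //; lia.
(* A positive logarithm absorbs the terms linear in [n]. *)
have l0 : 0 < trunc_log 2 n by rewrite trunc_log2S.
have := leq_pmulr n l0; move: (trunc_log 2 n) => l h; rewrite !mulnDr mulnS; nia.
Qed.

End Transform.

(** Excludes a total of one edge, for which the logarithm would vanish: an edge of [F] joins two
    distinct vertices, and [F'] needs an edge to connect them. *)
Lemma spanning_forest_card_gt0 (V : finType) (E F F' : {set {set V}}) :
  simple_graph E -> spanning_forest E F -> spanning_forest E F' ->
  0 < #|F| -> 0 < #|F'|.
Proof.
move=> sE [FE _ _] [_ _ sp] /card_gt0P[e eF]; have eE := subsetP FE _ eF.
have [x [y [exy xy]]] := edge_ends sE eE.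
have : connect (adj F') x y by apply: sp; apply: connect1; rewrite /adj -exy.
case/connectP=> [[|z p]] /=; first by move=> _ yx; rewrite yx eqxx in xy.
by case/andP=> xz _ _; apply/card_gt0P; exists [set x; z].
Qed.

Theorem theorem3 :
  exists (p : cmd) (C : nat),
  forall (R : realDomainType) (V : finType) (E : {set {set V}})
    (w : {set V} -> R) (F F' : {set {set V}}),
  simple_graph E -> spanning_forest E F -> spanning_forest E F' ->
  forall (vertex_num : V -> nat) (edge_num : {set V} -> nat) (wle : rel nat)
    (m : memory),
  input E w F F' vertex_num edge_num wle m ->
  exists (phases : seq (op {set V} * op {set V})) (m' : memory) (t : nat),
    [/\ gradual_transformation E
          (fun S => spanning_forest E S /\
             (weight w S <= Num.max (weight w F) (weight w F'))%R)
          F F' phases,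
        exec wle p m m' [seq map_op edge_num o | o <- ops_of_phases phases] t
      & t <= C * ((#|F| + #|F'|) * trunc_log 2 (#|F| + #|F'|)).+1].
Proof.
(* Two empty forests are handled apart, as the graph may then have no vertex. The constant exceeds
   that of [transform_correct] by 1 to pay for this test. *)
exists (If (Leq (Add (Var vk) (Var vk')) (Const 0)) Skip transform), 132.
move=> R V E w F F' sE sF sF' nu en wle m inp.
have kE : var m vk = #|F| := input_sizeF inp.
have k'E : var m vk' = #|F'| := input_sizeF' inp.
suff : run wle (If (Leq (Add (Var vk) (Var vk')) (Const 0)) Skip transform) m
    (fun m' tr t => exists ph,
    [/\ gradual_transformation E
          (good E w (fun s : bool => if s then F' else F)) F F' ph, tr = trace en ph
      & t <= 132 * ((#|F| + #|F'|) * trunc_log 2 (#|F| + #|F'|)).+1]).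
  by move=> [m' [tr [t [ex [ph [gr trE tle]]]]]]; exists ph, m', t; split=> //; move: ex; rewrite trE.
have g1 := spanning_forest_card_gt0 sE sF sF'.
have g2 := spanning_forest_card_gt0 sE sF' sF.
apply: run_if => /=; rewrite kE k'E => n0.
  have F0 : F = set0 by apply/eqP; rewrite -cards_eq0; lia.
  have F'0 : F' = set0 by apply/eqP; rewrite -cards_eq0; lia.
  by step; exists [::]; rewrite F0 F'0; split=> //; rewrite mulnS; apply: leq_trans (leq_addr _ _).
have n1 : 1 < #|F| + #|F'| by lia.
have /card_gt0P[e eF] : 0 < #|F| by lia.
have [x _] := edge_ends sE (subsetP (let: And3 h _ _ := sF in h) _ eF).
have := transform_correct sE sF sF' inp x n1.
move/run_conseq; apply=> m' tr t [ph [gr trE tle]]; exists ph; split=> //.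
by apply: leq_ltn_trans tle _; rewrite ltn_pmul2r.
Qed.
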